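(* Consider the graded manifold $\hat M=(M,\Gamma\Lambda S)$ and a connection $D$ on $S$, which defines the map $\imath:\Gamma S\to\mathfrak X(\hat M)$. Let $\mathcal K\subset\{\eta\in\Gamma S\mid D^C\eta=0\}$ be a linear subspace such that $(\mathcal K,D)$ is admissible. Then for all $\varphi,\psi\in\mathcal K$ $$\big[\imath(\varphi),\imath(\psi)\big]=\mathfrak B(R;\varphi,\psi)+\tfrac12\,\mathfrak D(\mathcal T;\varphi,\psi),$$ where $$\mathfrak B(R;\varphi,\psi)=\gamma^\mu\varphi\wedge\gamma^\nu\psi\wedge R_{\mu\nu},\qquad \mathfrak D(\mathcal T;\varphi,\psi)=\big(\gamma^\mu\varphi\wedge\mathcal T_{\mu\nu}\psi+\gamma^\mu\psi\wedge\mathcal T_{\mu\nu}\varphi\big)\otimes D^\nu .$$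
   Context: $(M,g)$ is a (pseudo-)Riemannian spin manifold with Levi-Civita connection $\nabla$ (also on the spinor bundle $S$) and Clifford multiplication $\gamma$, $\gamma(X)\gamma(Y)+\gamma(Y)\gamma(X)=-2g(X,Y)$; $\gamma_\mu=\gamma(e_\mu)$ for a local frame, indices raised with $g$. $C$ is a fixed charge conjugation: a non-degenerate spin-invariant bilinear form on $S$. For $\Phi\in\mathrm{End}(S)$, $\Phi^C$ is defined by $C(\Phi^C\eta,\xi)=C(\eta,\Phi\xi)$. For a connection $D=\nabla+\mathcal A$ on $S$: $D^C:=\nabla-\mathcal A^C$; $(\hat D_Z\gamma)(X)\xi:=D_Z(\gamma(X)\xi)-\gamma(\nabla_ZX)\xi-\gamma(X)D^C_Z\xi$; torsion $\mathcal T(X,Y):=(\hat D_X\gamma)(Y)-(\hat D_Y\gamma)(X)$; curvature $R(X,Y)=[D_X,D_Y]-D_{[X,Y]}$. The pair $(\mathcal K,D)$, $\mathcal K\subset\Gamma S$, is admissible if $\big((\hat D_X\gamma)(Y)+(\hat D_Y\gamma)(X)\big)\eta=0$ for all $\eta\in\mathcal K$ and all vector fields $X,Y$. The superfunctions of $\hat M$ are the sections of the exterior bundle $\Lambda S$; $\mathfrak X(\hat M)$ is the space of graded derivations of $\Gamma\Lambda S$, with the graded commutator $[\cdot,\cdot]$ (for two odd derivations, $[P,Q]=PQ+QP$). $D$ acts on $\Gamma\Lambda S$ as a derivation of degree $0$. The odd vector field $\imath(\varphi)$ is $\imath(\varphi)=\gamma^\mu\varphi\otimes D_\mu$, i.e.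 the derivation $\omega\mapsto\gamma^\mu\varphi\wedge D_\mu\omega$ of $\Gamma\Lambda S$. Endomorphisms of $S$ act on $\Gamma\Lambda S$ as derivations of degree $0$ vanishing on $C^\infty(M)$. Thus $\mathfrak B(R;\varphi,\psi)$ is the derivation $\omega\mapsto\gamma^\mu\varphi\wedge\gamma^\nu\psi\wedge R_{\mu\nu}(\omega)$, and $\mathfrak D(\mathcal T;\varphi,\psi)$ is the derivation $\omega\mapsto(\gamma^\mu\varphi\wedge\mathcal T_{\mu\nu}\psi+\gamma^\mu\psi\wedge\mathcal T_{\mu\nu}\varphi)\wedge D^\nu\omega$. *)

(* Defs.v *)
From HB Require Import structures.
From mathcomp Require Import all_boot all_order all_algebra.

Set Implicit Arguments.
Unset Strict Implicit.
Unset Printing Implicit Defensive.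

Import Order.TTheory GRing.Theory Num.Theory.
Local Open Scope ring_scope.

(** * The exterior algebra of R^N *)

(* [w I] is the coefficient of e_{i1} /\ ... /\ e_{ik} for
   I = {i1 < ... < ik}. *)
Definition ext (R : comNzRingType) (N : nat) := {ffun {set 'I_N} -> R^o}.

Section Exterior.
Variables (R : comNzRingType) (N : nat).
Implicit Types (w z : ext R N) (I J : {set 'I_N}).

(* e_I /\ e_J = shuffle_sign I J e_(I u J) for disjoint I and J *)
Definition shuffle_sign I J : R :=
  \prod_(i in I) \prod_(j in J) (-1) ^+ (j < i)%N.

Definition wedge w z : ext R N :=
  [ffun K : {set 'I_N} => \sum_(I : {set 'I_N} | I \subset K)
     shuffle_sign I (K :\: I) * w I * z (K :\: I)].

Definition ext1 : ext R N := [ffun I : {set 'I_N} => (I == set0)%:R].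

Definition vec (u : 'cV[R]_N) : ext R N :=
  [ffun I : {set 'I_N} => \sum_k u k 0 *+ (I == [set k])].

(* interior product with the k-th vector of the dual basis *)
Definition contract (k : 'I_N) w : ext R N :=
  [ffun I : {set 'I_N} =>
     if k \in I then 0 else shuffle_sign [set k] I * w (k |: I)].

(* the extension of an endomorphism as a derivation of degree 0 *)
Definition der (F : 'M[R]_N) w : ext R N :=
  \sum_k wedge (vec (col k F)) (contract k w).

(* the extension of an endomorphism as an algebra morphism *)
Definition extmap (h : 'M[R]_N) w : ext R N :=
  \sum_(I : {set 'I_N}) w I *: \big[wedge/ext1]_(k in I) vec (col k h).

End Exterior.

From mathcomp Require Import all_classical all_reals all_analysis.
Import numFieldNormedType.Exports.

Local Open Scope classical_set_scope.

(** * Smooth manifolds *)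

(* [f] is k+1 times differentiable on the open set [O]: [f] is (Frechet)
   differentiable on [O], and so are its iterated directional derivatives of
   order at most k. *)
Fixpoint times_differentiable (R : realType) (n k : nat) (O : set 'rV[R]_n)
    (f : 'rV[R]_n -> R^o) : Prop :=
  (forall x, O x -> differentiable f x) /\
  (if k is k'.+1 then forall v, times_differentiable k' O ('D_v f) else True).

Definition Cinfty (R : realType) (n : nat) (O : set 'rV[R]_n)
    (f : 'rV[R]_n -> R^o) : Prop :=
  forall k, times_differentiable k O f.

Structure manifold (R : realType) (n : nat) := Manifold {
  mcarrier :> topologicalType;
  mhausdorff : hausdorff_space mcarrier;
  mcountable : @second_countable mcarrier;
  atlas : Type;
  cdom : atlas -> set mcarrier;
  chart : atlas -> mcarrier -> 'rV[R]_n;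
  chart_inv : atlas -> 'rV[R]_n -> mcarrier;
  cdom_open : forall a, open (cdom a);
  cdom_cover : forall x, exists a, cdom a x;
  chart_img_open : forall a, open (chart a @` cdom a);
  chartK : forall a, {in cdom a, cancel (chart a) (chart_inv a)};
  chart_cont : forall a x, cdom a x -> {for x, continuous (chart a)};
  chart_inv_cont : forall a y, (chart a @` cdom a) y ->
    {for y, continuous (chart_inv a)};
  chart_trans : forall a b j, Cinfty (chart a @` (cdom a `&` cdom b))
    (fun y => chart b (chart_inv a y) 0 j)
}.

(* Functions are total; [smooth_on U f] only constrains [f] on the open [U]. *)
Definition smooth_on (R : realType) (n : nat) (M : manifold R n) (U : set M)
    (f : M -> R) : Prop :=
  forall a : atlas M,
    Cinfty (chart a @` (cdom a `&` U)) (fun y => f (chart_inv a y)).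

Definition smooth_at (R : realType) (n : nat) (M : manifold R n) (x : M)
    (f : M -> R) : Prop :=
  exists U : set M, [/\ open U, U x & smooth_on U f].

(** * Tangent vectors and vector fields *)

(* T_xM is the space of derivations of the algebra of germs at [x] of smooth
   functions.  The value on functions that are not smooth near [x] is
   normalised to 0, so that Leibniz equality is equality of tangent vectors. *)
Definition is_tangent (R : realType) (n : nat) (M : manifold R n) (x : M)
    (v : (M -> R) -> R) : Prop :=
  [/\ forall c f h, smooth_at x f -> smooth_at x h ->
        v (fun y => c * f y + h y) = c * v f + v h,
      forall f h, smooth_at x f -> smooth_at x h ->
        v (fun y => f y * h y) = v f * h x + f x * v h,
      forall f h, smooth_at x f -> smooth_at x h ->
        (\forall y \near x, f y = h y) -> v f = v h
    & forall f, ~ smooth_at x f -> v f = 0].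

Definition tangent_pred (R : realType) (n : nat) (M : manifold R n) (x : M) :
    {pred (M -> R) -> R} := fun v => `[< is_tangent x v >].

Lemma tangent_submod_closed (R : realType) (n : nat) (M : manifold R n) (x : M) :
  submod_closed (tangent_pred x).
Proof.
split=> [|c u v /asboolP[u1 u2 u3 u4] /asboolP[v1 v2 v3 v4]]; apply/asboolP.
  have E f : (0 : (M -> R) -> R) f = 0 by [].
  by split=> *; rewrite !E ?mul0r ?mulr0 ?addr0.
have E f : (c *: u + v) f = c * u f + v f by [].
split=> [k f h sf sh|f h sf sh|f h sf sh e|f sf]; rewrite !E.
- by rewrite u1// v1// !mulrDr !mulrA (mulrC k c) addrACA.
- by rewrite u2// v2// !mulrDr !mulrDl !mulrA (mulrC (f x) c) addrACA.
- by rewrite (u3 f h)// (v3 f h).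
- by rewrite u4// v4// mulr0 addr0.
Qed.

HB.instance Definition _ (R : realType) (n : nat) (M : manifold R n) (x : M) :=
  GRing.isSubmodClosed.Build R ((M -> R) -> R) (tangent_pred x)
    (tangent_submod_closed x).

Record tspace (R : realType) (n : nat) (M : manifold R n) (x : M) := TSpace {
  tval :> (M -> R) -> R;
  _ : tval \in tangent_pred x
}.

HB.instance Definition _ (R : realType) (n : nat) (M : manifold R n) (x : M) :=
  [isSub for @tval R n M x].
HB.instance Definition _ (R : realType) (n : nat) (M : manifold R n) (x : M) :=
  [Choice of tspace x by <:].
HB.instance Definition _ (R : realType) (n : nat) (M : manifold R n) (x : M) :=
  [SubChoice_isSubLmodule of tspace x by <:].

Definition vfield (R : realType) (n : nat) (M : manifold R n) : Type :=
  forall x : M, tspace x.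

Section Manifold.
Variables (R : realType) (n : nat) (M : manifold R n).
Implicit Types (x : M) (U V : set M) (X Y Z : vfield M).

Definition vsmooth U X : Prop :=
  forall V (f : M -> R), open V -> V `<=` U -> smooth_on V f ->
    smooth_on V (fun x => X x f).

Definition vsmooth_at x X : Prop :=
  exists U : set M, [/\ open U, U x & vsmooth U X].

(* [X, Y]_x; the default value 0 is only used when [X] or [Y] is not smooth
   near x. *)
Definition lie_bracket X Y : vfield M := fun x =>
  insubd (0 : tspace x) (fun f =>
    if `[< smooth_at x f >] then X x (fun y => Y y f) - Y x (fun y => X y f)
    else 0).

Definition frame_on U (b : 'I_n -> vfield M) : Prop :=
  (forall mu, vsmooth U (b mu)) /\
  (forall x (v : tspace x), U x ->
     exists! c : 'rV[R]_n, v = \sum_mu c 0 mu *: b mu x).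

Structure metric := Metric {
  met :> forall x, tspace x -> tspace x -> R;
  met_sym : forall x (u v : tspace x), met u v = met v u;
  met_lin : forall x c (u v w : tspace x),
    met (c *: u + v) w = c * met u w + met v w;
  met_nondeg : forall x (u : tspace x), (forall v, met u v = 0) -> u = 0;
  met_smooth : forall U X Y, open U -> vsmooth U X -> vsmooth U Y ->
    smooth_on U (fun x => met (X x) (Y x))
}.

(* [nab x v Y] is the covariant derivative of Y in the direction of v in T_xM;
   it is defined on vector fields that are smooth near [x]. *)
Definition affine_connection : Type :=
  forall x : M, tspace x -> vfield M -> tspace x.

Definition is_affine_connection (nab : affine_connection) : Prop :=
  [/\ forall x c (u v : tspace x) Y, vsmooth_at x Y ->
        nab x (c *: u + v) Y = c *: nab x u Y + nab x v Y,
      forall x (v : tspace x) Y Z, vsmooth_at x Y -> vsmooth_at x Z ->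
        nab x v (fun y => Y y + Z y) = nab x v Y + nab x v Z,
      forall x (v : tspace x) f Y, smooth_at x f -> vsmooth_at x Y ->
        nab x v (fun y => f y *: Y y) = v f *: Y x + f x *: nab x v Y,
      forall x (v : tspace x) Y Z, vsmooth_at x Y -> vsmooth_at x Z ->
        (\forall y \near x, Y y = Z y) -> nab x v Y = nab x v Z
    & forall U X Y, open U -> vsmooth U X -> vsmooth U Y ->
        vsmooth U (fun x => nab x (X x) Y)].

Definition levi_civita (g : metric) (nab : affine_connection) : Prop :=
  [/\ is_affine_connection nab,
      forall x (v : tspace x) Y Z, vsmooth_at x Y -> vsmooth_at x Z ->
        v (fun y => g y (Y y) (Z y)) =
          g x (nab x v Y) (Z x) + g x (Y x) (nab x v Z)
    & forall x X Y, vsmooth_at x X -> vsmooth_at x Y ->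
        nab x (X x) Y - nab x (Y x) X = lie_bracket X Y x].

Definition gram (g : metric) (b : 'I_n -> vfield M) x : 'M[R]_n :=
  \matrix_(mu, nu) g x (b mu x) (b nu x).

(* g^{mu nu} in the frame [b] *)
Definition ginv (g : metric) (b : 'I_n -> vfield M) x : 'M[R]_n :=
  invmx (gram g b x).

End Manifold.

(** * Clifford modules and the spin group *)

(* diagonal entries of the standard form of signature (p, n - p) *)
Definition eta (R : realType) (n p : nat) (a : 'I_n) : R :=
  if (a < p)%N then 1 else -1.

(* A real representation space R^N of the Clifford algebra of signature
   (p, n - p), given by its gamma matrices; irreducibility is not needed. *)
Structure clifford_module (R : realType) (n p N : nat) := CliffordModule {
  gam :> 'I_n -> 'M[R]_N;
  gam_dim : (0 < N)%N;
  gam_rel : forall a b,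
    gam a *m gam b + gam b *m gam a = (- 2 * (eta R p a *+ (a == b)))%:M
}.

Section Spin.
Variables (R : realType) (n p N : nat) (G : clifford_module R n p N).

Definition qform (v : 'rV[R]_n) : R := \sum_a eta R p a * v 0 a ^+ 2.

Definition gamvec (v : 'rV[R]_n) : 'M[R]_N := \sum_a v 0 a *: G a.

(* Spin(p, n - p) consists of the products of an even number of vectors of
   norm +1 or -1.  The even Clifford algebra acts faithfully on every nonzero
   Clifford module, so the group is identified with its image in GL_N. *)
Definition spin_group (h : 'M[R]_N) : Prop :=
  exists s : seq 'rV[R]_n,
    [/\ ~~ odd (size s), all (fun v => (qform v == 1) || (qform v == -1)) s
      & h = \big[mulmx/1%:M]_(v <- s) gamvec v].

(* the preimage Spin^+ of the identity component of SO(p, n - p): in addition,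
   the number of vectors of norm -1 is even *)
Definition spin_group0 (h : 'M[R]_N) : Prop :=
  exists s : seq 'rV[R]_n,
    [/\ ~~ odd (size s), all (fun v => (qform v == 1) || (qform v == -1)) s,
        ~~ odd (count (fun v => qform v == -1) s)
      & h = \big[mulmx/1%:M]_(v <- s) gamvec v].

End Spin.

(* Clifford action on R^N of a tangent vector, in an orthonormal frame [e] *)
Definition cliff (R : realType) (n p N : nat) (M : manifold R n) (g : metric M)
    (G : clifford_module R n p N) (e : 'I_n -> vfield M) (x : M) (v : tspace x) :
    'M[R]_N :=
  \sum_a (eta R p a * g x v (e a x)) *: G a.

(* A spin structure, as a Spin-valued cocycle [strans] lifting the transition
   functions between local orthonormal frames [sframe i].  The spinor bundle
   is the bundle with fibre R^N and transition functions [strans]. *)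
Structure spin_structure (R : realType) (n p N : nat) (M : manifold R n)
    (g : metric M) (G : clifford_module R n p N) := SpinStructure {
  gauge : Type;
  sdom : gauge -> set M;
  sframe : gauge -> 'I_n -> vfield M;
  strans : gauge -> gauge -> M -> 'M[R]_N;
  sdom_open : forall i, open (sdom i);
  sdom_cover : forall x, exists i, sdom i x;
  sframe_frame : forall i, frame_on (sdom i) (sframe i);
  sframe_orthonormal : forall i x a b, sdom i x ->
    g x (sframe i a x) (sframe i b x) = eta R p a *+ (a == b);
  strans_smooth : forall i j k l,
    smooth_on (sdom i `&` sdom j) (fun x => strans i j x k l);
  strans_spin : forall i j x, sdom i x -> sdom j x ->
    spin_group G (strans i j x);
  strans_cocycle : forall i j k x, sdom i x -> sdom j x -> sdom k x ->
    strans i j x *m strans j k x = strans i k x;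
  (* strans i j covers the change of frame:
     h gam_b h^-1 = gamma(e_{j,b}), computed in the gauge i *)
  strans_lift : forall i j x b, sdom i x -> sdom j x ->
    strans i j x *m G b = cliff g G (sframe i) (sframe j b x) *m strans i j x
}.

(** * Spinors and superfunctions *)

(* A section of S, or of its exterior bundle, is the family of its local
   representatives in the gauges of the spin structure.  The representative of
   index i is only meaningful on [sdom i]. *)

Section Spinors.
Variables (R : realType) (n p N : nat) (M : manifold R n) (g : metric M)
  (G : clifford_module R n p N) (S : spin_structure g G).

Definition spinor : Type := gauge S -> M -> 'cV[R]_N.
Definition superfun : Type := gauge S -> M -> ext R N.

Definition is_spinor_section (xi : spinor) : Prop :=
  (forall i k, smooth_on (sdom i) (fun x => xi i x k 0)) /\
  (forall i j x, sdom i x -> sdom j x -> xi i x = strans i j x *m xi j x).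

Definition is_superfun_section (w : superfun) : Prop :=
  (forall i I, smooth_on (sdom i) (fun x => w i x I)) /\
  (forall i j x, sdom i x -> sdom j x -> w i x = extmap (strans i j x) (w j x)).

Definition clifford (X : vfield M) (xi : spinor) : spinor :=
  fun i x => cliff g G (sframe (s := S) i) (X x) *m xi i x.

(* The bilinear form on S is given by the same matrix [C] in all gauges:
   C(eta, xi) = eta^T C xi.  It is invariant under Spin^+, and under the transition functions of S.  (Invariance under
   the full group Spin(p, q) would exclude the usual charge conjugations in
   indefinite signature.) *)
Definition charge_conjugation (C : 'M[R]_N) : Prop :=
  [/\ C \in unitmx,
      forall h, spin_group0 G h -> h^T *m C *m h = C
    & forall (i j : gauge S) x, sdom i x -> sdom j x ->
        (strans i j x)^T *m C *m strans i j x = C].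

(* Phi^C, characterised by C(Phi^C eta, xi) = C(eta, Phi xi): see conjCP *)
Definition conjC_mx (C F : 'M[R]_N) : 'M[R]_N := (C *m F *m invmx C)^T.

(* End(S)-valued one-forms *)
Definition end_form : Type :=
  forall (i : gauge S) (x : M), {linear tspace x -> 'M[R]_N}.

Definition is_end_form (A : end_form) : Prop :=
  (forall i U X, open U -> U `<=` sdom i -> vsmooth U X ->
     forall k l, smooth_on U (fun x => A i x (X x) k l)) /\
  (forall i j x v, sdom i x -> sdom j x ->
     A i x v *m strans i j x = strans i j x *m A j x v).

Variables (nab : affine_connection M) (C : 'M[R]_N) (A : end_form).

(* connection form of the spinorial Levi-Civita connection in the gauge i:
   1/4 sum_{b,c} g(nabla_v e_b, e_c) gamma^b gamma^c *)
Definition spin_form (i : gauge S) (x : M) (v : tspace x) : 'M[R]_N :=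
  4^-1 *: \sum_b \sum_c
    (eta R p b * eta R p c * g x (nab v (sframe i b)) (sframe i c x))
      *: (G b *m G c).

Definition dspinor (x : M) (v : tspace x) (xi : M -> 'cV[R]_N) : 'cV[R]_N :=
  \col_k v (fun y => xi y k 0).

Definition dext (x : M) (v : tspace x) (w : M -> ext R N) : ext R N :=
  [ffun I : {set 'I_N} => v (fun y => w y I)].

(* D = nabla + A *)
Definition D (X : vfield M) (xi : spinor) : spinor := fun i x =>
  dspinor (X x) (xi i) + (spin_form i (X x) + A i x (X x)) *m xi i x.

(* D^C = nabla - A^C *)
Definition DC (X : vfield M) (xi : spinor) : spinor := fun i x =>
  dspinor (X x) (xi i) + (spin_form i (X x) - conjC_mx C (A i x (X x))) *m xi i x.

(* D on superfunctions, as a derivation of degree 0 *)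
Definition Dext (X : vfield M) (w : superfun) : superfun := fun i x =>
  dext (X x) (w i) + der (spin_form i (X x) + A i x (X x)) (w i x).

Definition nabla (X Y : vfield M) : vfield M := fun x => nab (X x) Y.

(* (\hat D_Z gamma)(X) xi *)
Definition Dhat (Z X : vfield M) (xi : spinor) : spinor :=
  D Z (clifford X xi) - clifford (nabla Z X) xi - clifford X (DC Z xi).

Definition torsion (X Y : vfield M) (xi : spinor) : spinor :=
  Dhat X Y xi - Dhat Y X xi.

Definition curvature (X Y : vfield M) (xi : spinor) : spinor :=
  D X (D Y xi) - D Y (D X xi) - D (lie_bracket X Y) xi.

(* the matrix of the endomorphism R(X, Y)_x in the gauge i: its l-th column is
   R(X, Y) applied to the l-th local spinor frame section *)
Definition curvature_mx (X Y : vfield M) (i : gauge S) (x : M) : 'M[R]_N :=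
  \matrix_(k, l) curvature X Y (fun _ _ => delta_mx l 0) i x k 0.

(* D^C eta = 0 *)
Definition parallelC (xi : spinor) : Prop :=
  forall (i : gauge S) (U : set M) X, open U -> vsmooth U X ->
    forall x, U x -> sdom i x -> DC X xi i x = 0.

Definition linear_subspace (K : set spinor) : Prop :=
  K 0 /\ forall (c : R) (xi zeta : spinor), K xi -> K zeta -> K (c *: xi + zeta).

(* The condition is tensorial in X and Y; it is required for vector fields on
   arbitrary open subsets, so that it applies to local frames. *)
Definition admissible (K : set spinor) : Prop :=
  forall xi, K xi -> forall (U : set M) X Y, open U -> vsmooth U X -> vsmooth U Y ->
    forall (i : gauge S) x, U x -> sdom i x ->
      (Dhat X Y xi + Dhat Y X xi) i x = 0.

Definition wedges (w z : superfun) : superfun := fun i x => wedge (w i x) (z i x).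
Definition vecs (xi : spinor) : superfun := fun i x => vec (xi i x).

(* graded commutator of operators of parities s and t *)
Definition gcomm (s t : bool) (P Q : superfun -> superfun) : superfun -> superfun :=
  fun w => P (Q w) - (-1) ^+ (s && t) *: Q (P w).

Variable b : 'I_n -> vfield M.

(* gamma^mu phi, where indices refer to an arbitrary local frame [b] *)
Definition gamma_up (mu : 'I_n) (xi : spinor) : spinor := fun i x =>
  \sum_nu ginv g b x mu nu *: clifford (b nu) xi i x.

(* D^nu on superfunctions *)
Definition D_up (nu : 'I_n) (w : superfun) : superfun := fun i x =>
  \sum_rho ginv g b x nu rho *: Dext (b rho) w i x.

Definition imath (phi : spinor) (w : superfun) : superfun :=
  \sum_mu wedges (vecs (gamma_up mu phi)) (Dext (b mu) w).

Definition frakB (phi psi : spinor) (w : superfun) : superfun :=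
  \sum_mu \sum_nu
    wedges (wedges (vecs (gamma_up mu phi)) (vecs (gamma_up nu psi)))
      (fun i x => der (curvature_mx (b mu) (b nu) i x) (w i x)).

Definition frakD (phi psi : spinor) (w : superfun) : superfun :=
  \sum_mu \sum_nu
    wedges (wedges (vecs (gamma_up mu phi)) (vecs (torsion (b mu) (b nu) psi)) +
            wedges (vecs (gamma_up mu psi)) (vecs (torsion (b mu) (b nu) phi)))
      (D_up nu w).

End Spinors.

Lemma conjCP (R : realType) (N : nat) (C F : 'M[R]_N) (xi zeta : 'cV[R]_N) :
  C \in unitmx ->
  (conjC_mx C F *m xi)^T *m C *m zeta = xi^T *m C *m (F *m zeta).
Proof.
by move=> uC; rewrite trmx_mul trmxK !mulmxA -(mulmxA _ (invmx C)) mulVmx ?mulmx1.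
Qed.

(* Main.v *)
Require Import Defs.
From mathcomp Require Import all_boot all_order all_algebra ring.

(* Since D acts on superfunctions as a derivation, the graded commutator of
   gamma^mu phi D_mu and gamma^nu psi D_nu splits into terms with
   gamma^mu phi /\ gamma^nu psi /\ [D_mu, D_nu] and terms with
   gamma^mu phi /\ D_mu(gamma^nu psi) /\ D_nu and with phi, psi exchanged.  The
   first give the curvature and a term with [e_mu, e_nu].  As D^C psi = 0 and
   admissibility makes (\hat D_mu gamma)(e_nu) psi antisymmetric, hence half the
   torsion, the second give the torsion term and
   gamma^mu phi /\ gamma(nabla_mu e^nu) psi /\ D_nu.  Metric compatibility turns
   nabla_mu e^nu into minus the Christoffel symbols, and these cancel the
   [e_mu, e_nu] term because nabla is torsion-free. *)

Set Implicit Arguments.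
Unset Strict Implicit.
Unset Printing Implicit Defensive.

Import Order.TTheory GRing.Theory Num.Theory.
Local Open Scope ring_scope.

(** * Exterior algebra *)

(** The claim equates values at one point in one gauge, so the analysis takes place on an open set W
    carrying both the frame and the gauge, and the final index computation sees the geometry only
    through formulas at x for D_mu(gamma^nu phi), D_mu(gamma^nu psi) and [D_mu, D_nu] w. The
    obstacle is that a tangent vector is a functional on all functions, equal to 0 on those not
    smooth near x: a product rule is available only once every factor is known to be smooth on an
    open neighbourhood, which is why smoothness lemmas accompany each construction. Two odd fields
    have a sum as bracket; a commutator of D_mu and D_nu still appears, because exchanging the two
    spinors in the second summand costs a sign. The exterior algebra is handled through
    multiplications by vectors and contractions: their anticommutation relations give both the
    Leibniz rule for [der] and its compatibility with commutators. The frame is arbitrary, so g^{mu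
    nu} has to be differentiated too. *)

Section ExteriorAlgebra.
Variables (R : comNzRingType) (N : nat).
Implicit Types (i j k l : 'I_N) (w z y : ext R N) (I J K L : {set 'I_N}) (u v : 'cV[R]_N).
Local Notation sgn := (shuffle_sign R).

Lemma shuffle_signUl I J L :
  [disjoint I & J] -> sgn (I :|: J) L = sgn I L * sgn J L.
Proof.
move=> dIJ; rewrite /shuffle_sign -bigU //; apply: eq_bigl => i.
by rewrite !inE.
Qed.

Lemma shuffle_signUr I J L :
  [disjoint J & L] -> sgn I (J :|: L) = sgn I J * sgn I L.
Proof.
move=> dJL; rewrite /shuffle_sign -big_split; apply: eq_bigr => i _ /=.
by rewrite (eq_bigl [predU J & L]) ?bigU // => j; rewrite !inE.
Qed.

Lemma shuffle_sign11 j k : sgn [set j] [set k] = (-1) ^+ (k < j)%N.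
Proof. by rewrite /shuffle_sign !big_set1. Qed.

Lemma shuffle_sign_sqr I J : sgn I J * sgn I J = 1.
Proof.
rewrite -expr2 -prodrXl big1 // => i _.
by rewrite -prodrXl big1 // => j _; rewrite sqrr_sign.
Qed.

Lemma shuffle_sign_swap j k :
  j != k -> sgn [set j] [set k] = - sgn [set k] [set j].
Proof.
rewrite !shuffle_sign11 => jk; case: ltngtP => //; rewrite ?expr0 ?expr1 ?opprK//.
by move=> /val_inj e; rewrite e eqxx in jk.
Qed.

Lemma wedgeDl w w' z : wedge (w + w') z = wedge w z + wedge w' z.
Proof.
apply/ffunP=> K; rewrite !ffunE -big_split; apply: eq_bigr => I _.
by rewrite ffunE mulrDr mulrDl.
Qed.

Lemma wedgeDr w z z' : wedge w (z + z') = wedge w z + wedge w z'.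
Proof.
apply/ffunP=> K; rewrite !ffunE -big_split; apply: eq_bigr => I _.
by rewrite ffunE mulrDr.
Qed.

Lemma wedgeZl c w z : wedge (c *: w) z = c *: wedge w z.
Proof.
apply/ffunP=> K; rewrite !ffunE scaler_sumr; apply: eq_bigr => I _.
by rewrite ffunE /GRing.scale /=; ring.
Qed.

Lemma wedgeZr c w z : wedge w (c *: z) = c *: wedge w z.
Proof.
apply/ffunP=> K; rewrite !ffunE scaler_sumr; apply: eq_bigr => I _.
by rewrite ffunE /GRing.scale /=; ring.
Qed.

Lemma wedge0l z : wedge 0 z = 0.
Proof. by have := wedgeZl 0 0 z; rewrite !scale0r. Qed.

Lemma wedge0r z : wedge z 0 = 0.
Proof. by have := wedgeZr 0 z 0; rewrite !scale0r. Qed.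

Lemma wedgeNr w z : wedge w (- z) = - wedge w z.
Proof. by rewrite -!scaleN1r wedgeZr. Qed.

Lemma wedge_suml (T : Type) (r : seq T) (P : pred T) (F : T -> ext R N) z :
  wedge (\sum_(i <- r | P i) F i) z = \sum_(i <- r | P i) wedge (F i) z.
Proof.
exact: (big_morph (fun w => wedge w z) (fun a b => wedgeDl a b z) (wedge0l z)).
Qed.

Lemma wedge_sumr (T : Type) (r : seq T) (P : pred T) (F : T -> ext R N) z :
  wedge z (\sum_(i <- r | P i) F i) = \sum_(i <- r | P i) wedge z (F i).
Proof.
exact: (big_morph (fun w => wedge z w) (wedgeDr z) (wedge0r z)).
Qed.

(** Both sides run over chains I in A in K. With J = A minus I and L = K minus A, the signs agree
    because [shuffle_sign] is multiplicative over disjoint unions in either argument. *)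
Lemma wedgeA w z y : wedge w (wedge z y) = wedge (wedge w z) y.
Proof.
apply/ffunP=> K; rewrite !ffunE.
transitivity (\sum_(A : {set 'I_N} | A \subset K) \sum_(I : {set 'I_N} | I \subset A)
   sgn A (K :\: A) * (sgn I (A :\: I) * w I * z (A :\: I)) * y (K :\: A)); last first.
  by apply: eq_bigr => A _; rewrite ffunE mulr_sumr mulr_suml.
rewrite (exchange_big_dep (fun I => I \subset K)) /=; last first.
  by move=> A I AK IA; apply: subset_trans AK.
apply: eq_bigr => I IK; rewrite ffunE mulr_sumr.
rewrite [RHS](reindex_onto (fun J => I :|: J) (fun A => A :\: I)) /=; last first.
  move=> A /andP[_ /subsetP IA]; apply/setP => k; rewrite !inE.
  by have := IA k; case: (k \in I) => //= /(_ isT) ->.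
apply: eq_big => [J|J JK].
  rewrite finset.subsetD finset.subUset IK finset.subsetUl andbT /=; congr (_ && _).
  by rewrite finset.setDUl finset.setDv finset.set0U; apply/idP/eqP => /setDidPl.
have {JK}[dJI JK] : [disjoint I & J] /\ J \subset K.
  by move: JK; rewrite finset.subsetD disjoint_sym => /andP[].
set L := K :\: (I :|: J).
have -> : K :\: I :\: J = L by rewrite finset.setDDl.
have -> : K :\: I = J :|: L.
  apply/setP => k; rewrite !inE; have := subsetP JK k.
  have /pred0P/(_ k) /= := dJI.
  by case: (k \in I); case: (k \in J); case: (k \in K) => //= _ /(_ isT).
have -> : (I :|: J) :\: I = J.
  rewrite finset.setDUl finset.setDv finset.set0U; apply/setDidPl.
  by rewrite disjoint_sym.
have dJL : [disjoint J & L].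
  by apply/pred0P => k /=; rewrite !inE; case: (k \in J); rewrite ?orbT ?andbF.
rewrite shuffle_signUr // shuffle_signUl //; ring.
Qed.

Lemma vecD u v : vec (u + v) = vec u + vec v.
Proof.
apply/ffunP=> I; rewrite !ffunE -big_split; apply: eq_bigr => k _.
by rewrite mxE mulrnDl.
Qed.

Lemma vecZ c u : vec (c *: u) = c *: vec u.
Proof.
apply/ffunP=> I; rewrite !ffunE scaler_sumr; apply: eq_bigr => k _.
by rewrite mxE -mulrnAr.
Qed.

Lemma vec0 : vec (0 : 'cV[R]_N) = 0.
Proof. by have := vecZ 0 0; rewrite !scale0r. Qed.

Lemma vec_sum (T : Type) (r : seq T) (P : pred T) (F : T -> 'cV[R]_N) :
  vec (\sum_(i <- r | P i) F i) = \sum_(i <- r | P i) vec (F i).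
Proof. exact: (big_morph (fun u => vec u) vecD vec0). Qed.

Lemma contractD k w z : contract k (w + z) = contract k w + contract k z.
Proof.
by apply/ffunP=> I; rewrite !ffunE; case: ifP; rewrite ?addr0 // mulrDr.
Qed.

Lemma contractZ k c w : contract k (c *: w) = c *: contract k w.
Proof.
apply/ffunP=> I; rewrite !ffunE /GRing.scale /=; case: ifP => _; ring.
Qed.

Lemma contract_sum k (T : Type) (r : seq T) (P : pred T) (F : T -> ext R N) :
  contract k (\sum_(i <- r | P i) F i) = \sum_(i <- r | P i) contract k (F i).
Proof.
apply: (big_morph (fun w => contract k w) (contractD k)).
by have := contractZ k 0 0; rewrite !scale0r.
Qed.

Lemma vec_wedgeE u z I :
  wedge (vec u) z I =
  \sum_(k in I) shuffle_sign R [set k] (I :\ k) * u k 0 * z (I :\ k).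
Proof.
rewrite ffunE.
transitivity (\sum_(J : {set 'I_N} | J \subset I) \sum_(k | J == [set k])
   shuffle_sign R J (I :\: J) * u k 0 * z (I :\: J)).
  apply: eq_bigr => J _; rewrite ffunE mulr_sumr mulr_suml [RHS]big_mkcond.
  by apply: eq_bigr => k _; case: eqP => _; rewrite ?mulr0n ?mulr1n ?mulr0 ?mul0r.
rewrite (exchange_big_dep (fun k => k \in I)) /=; last first.
  by move=> J k JI /eqP eJ; rewrite -sub1set -eJ.
apply: eq_bigr => k kI; rewrite (big_pred1 [set k]) // => J /=.
by apply/andP/eqP => [[_ /eqP]//|->]; rewrite sub1set kI.
Qed.

(** Parallel in form to the definition of [contract]; the relations below thereby become comparisons
    of two signs on a fixed index set. *)
Lemma delta_wedgeE j z I :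
  wedge (vec (delta_mx j 0)) z I =
  if j \in I then shuffle_sign R [set j] (I :\ j) * z (I :\ j) else 0.
Proof.
rewrite vec_wedgeE; case: ifP => jI.
  rewrite (bigD1 j) //= big1 => [|k /andP[_ /negPf kj]];
    by rewrite mxE ?eqxx ?kj /= ?mulr1 ?mulr0 ?mul0r ?addr0.
rewrite big1 // => k kI; rewrite mxE; case: eqP => [e|_].
  by rewrite -e kI in jI.
by rewrite mulr0 mul0r.
Qed.

Lemma cV_sum_delta u : u = \sum_j u j 0 *: delta_mx j 0.
Proof.
by rewrite {1}[u]matrix_sum_delta; apply: eq_bigr => j _; rewrite big_ord1.
Qed.

Lemma vec_wedge_delta u z :
  wedge (vec u) z = \sum_j u j 0 *: wedge (vec (delta_mx j 0)) z.
Proof.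
rewrite {1}(cV_sum_delta u) vec_sum wedge_suml.
by apply: eq_bigr => j _; rewrite vecZ wedgeZl.
Qed.

(** Removing j and k from I in either order leaves the same L; the signs differ only by that of
    ({j}, {k}) against that of ({k}, {j}). *)
Lemma delta_wedgeC j k z :
  wedge (vec (delta_mx j 0)) (wedge (vec (delta_mx k 0)) z) =
  - wedge (vec (delta_mx k 0)) (wedge (vec (delta_mx j 0)) z).
Proof.
apply/ffunP => I; rewrite [RHS]ffunE !delta_wedgeE !inE.
have [->|njk] := eqVneq k j; first by rewrite /= mulr0 if_same oppr0.
rewrite /=.
case jI: (j \in I); case kI: (k \in I) => //=; rewrite ?mulr0 ?oppr0 //.
have e : I :\ j :\ k = I :\ k :\ j by rewrite !finset.setDDl finset.setUC.
rewrite e; set L := I :\ k :\ j.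
have -> : sgn [set j] (I :\ j) = sgn [set j] [set k] * sgn [set j] L.
  rewrite -shuffle_signUr; last by rewrite disjoints1 !inE eqxx andbF.
  by rewrite /L -e finset.setD1K // !inE njk kI.
have -> : sgn [set k] (I :\ k) = sgn [set k] [set j] * sgn [set k] L.
  rewrite -shuffle_signUr; last by rewrite disjoints1 !inE eqxx.
  by rewrite finset.setD1K // !inE eq_sym njk jI.
rewrite (@shuffle_sign_swap j k); last by rewrite eq_sym.
ring.
Qed.

Lemma vec_wedgeC u v z :
  wedge (vec u) (wedge (vec v) z) = - wedge (vec v) (wedge (vec u) z).
Proof.
rewrite !(vec_wedge_delta u) wedge_sumr -sumrN; apply: eq_bigr => j _.
rewrite wedgeZr !(vec_wedge_delta v) wedge_sumr -scalerN -sumrN; congr (_ *: _).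
by apply: eq_bigr => k _; rewrite !wedgeZr delta_wedgeC scalerN.
Qed.

Lemma contractC j k z : contract j (contract k z) = - contract k (contract j z).
Proof.
apply/ffunP => I; rewrite [RHS]ffunE !ffunE !inE.
have [->|njk] := eqVneq k j; first by rewrite /= mulr0 if_same oppr0.
rewrite /=.
case jI: (j \in I); case kI: (k \in I) => //=; rewrite ?mulr0 ?oppr0 //.
rewrite !shuffle_signUr ?disjoints1 ?inE ?kI ?jI //.
rewrite (@shuffle_sign_swap j k); last by rewrite eq_sym.
rewrite finset.setUCA; ring.
Qed.

(** With [vec_wedgeC] and [contractC] this completes the canonical anticommutation relations. By
    linearity it is checked on basis vectors, where u k 0 becomes a Kronecker delta. *)
Lemma contract_vec_wedge k u z :
  contract k (wedge (vec u) z) = u k 0 *: z - wedge (vec u) (contract k z).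
Proof.
rewrite !(vec_wedge_delta u) contract_sum.
have -> : u k 0 *: z = \sum_j u j 0 *: ((j == k)%:R *: z).
  rewrite (bigD1 k) //= eqxx scale1r big1 ?addr0 // => j /negPf ->.
  by rewrite scale0r scaler0.
rewrite -sumrB; apply: eq_bigr => j _.
rewrite contractZ -scalerBr; congr (_ *: _).
apply/ffunP => I; rewrite ffunE !delta_wedgeE [RHS]ffunE [in RHS]ffunE.
rewrite [in RHS]ffunE delta_wedgeE ffunE /GRing.scale /= !inE.
have [->|njk] := eqVneq j k; rewrite /= ?mul1r ?mul0r ?add0r.
  case kI: (k \in I).
    rewrite finset.setD1K // mulrA shuffle_sign_sqr mul1r.
    by rewrite subrr.
  rewrite finset.setU1K ?kI // mulrA shuffle_sign_sqr; ring.
case kI: (k \in I); case jI: (j \in I) => //=; rewrite ?mulr0 ?oppr0 //.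
have e : (k |: I) :\ j = k |: (I :\ j).
  apply/setP => l; rewrite !inE; have [->|] //= := eqVneq l k.
  by rewrite eq_sym njk.
rewrite e.
have -> : sgn [set k] I = sgn [set k] [set j] * sgn [set k] (I :\ j).
  rewrite -shuffle_signUr; last by rewrite disjoints1 !inE eqxx.
  by rewrite finset.setD1K.
rewrite shuffle_signUr; last by rewrite disjoints1 !inE kI andbF.
rewrite (@shuffle_sign_swap j k) //.
(* A squared sign is inserted as 1 on the right, to match the two signs between {j} and {k} that
   occur on the left. *)
by rewrite -[X in _ = - X]mul1r -(shuffle_sign_sqr [set k] [set j]); ring.
Qed.

(** Moving the contraction past u costs a sign and moving the column of F past u costs another, so
    the second term keeps its plus. *)
Lemma der_vec_wedge F u z :
  der F (wedge (vec u) z) = wedge (vec (F *m u)) z + wedge (vec u) (der F z).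
Proof.
rewrite /der wedge_sumr.
have -> : F *m u = \sum_k u k 0 *: col k F.
  apply/colP => l; rewrite mxE summxE; apply: eq_bigr => k _.
  by rewrite !mxE mulrC.
rewrite vec_sum wedge_suml -big_split; apply: eq_bigr => k _ /=.
rewrite contract_vec_wedge vecZ wedgeZl wedgeDr wedgeZr wedgeNr.
by rewrite vec_wedgeC opprK.
Qed.

Lemma derD F F' w : der (F + F') w = der F w + der F' w.
Proof.
rewrite -big_split; apply: eq_bigr => k _ /=.
by rewrite linearD /= vecD wedgeDl.
Qed.

Lemma derZ c F w : der (c *: F) w = c *: der F w.
Proof.
by rewrite scaler_sumr; apply: eq_bigr => k _; rewrite linearZ /= vecZ wedgeZl.
Qed.

Lemma derN F w : der (- F) w = - der F w.
Proof. by rewrite -!scaleN1r derZ. Qed.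

Lemma derDr F w z : der F (w + z) = der F w + der F z.
Proof.
rewrite -big_split; apply: eq_bigr => k _ /=.
by rewrite contractD wedgeDr.
Qed.

Lemma der_sumr F (T : Type) (r : seq T) (P : pred T) (f : T -> ext R N) :
  der F (\sum_(i <- r | P i) f i) = \sum_(i <- r | P i) der F (f i).
Proof.
apply: (big_morph (fun w => der F w) (derDr F)).
rewrite /der big1 // => k _.
have -> : contract k (0 : ext R N) = 0.
  by have := contractZ k 0 0; rewrite !scale0r.
exact: wedge0r.
Qed.

Lemma der_comm F H w :
  der F (der H w) - der H (der F w) = der (F *m H - H *m F) w.
Proof.
(* Normal ordering: [der F1] acting on the column of F2 gives the product F1 F2; the rest, with two
   wedges and two contractions, is symmetric in F1 and F2 and drops out of the commutator. *)
have E F1 F2 : der F1 (der F2 w) = der (F1 *m F2) w +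
    \sum_l \sum_k wedge (vec (col k F2))
      (wedge (vec (col l F1)) (contract l (contract k w))).
  rewrite [X in der F1 X]/der der_sumr [X in _ = _ + X]exchange_big -big_split.
  apply: eq_bigr => k _ /=.
  by rewrite der_vec_wedge [in RHS]colE -mulmxA -colE /der wedge_sumr.
rewrite !E derD derN opprD addrACA -[RHS]addr0; congr (_ + _).
rewrite [X in _ - X]exchange_big -sumrB big1 // => l _.
rewrite -sumrB big1 // => k _ /=.
by rewrite vec_wedgeC contractC wedgeNr wedgeNr opprK subrr.
Qed.

End ExteriorAlgebra.

(** * Index algebra of the bracket at a point *)

Section ConnectionAlgebra.
Variables (R : comNzRingType) (n N : nat) (c : R) (h : 'M[R]_n).
Variable Gam : 'I_n -> 'I_n -> 'I_n -> R.
Variable z : 'I_n -> ext R N.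
Local Notation Gz mu lam := (\sum_nu Gam mu lam nu *: z nu).

(** Moves the coefficients from the spinor slot to z: T is then paired with g^{nu rho} D_nu w, and v
    lam with D w along nabla_mu e_lam. *)
Lemma sum_wedge_covariant (y : ext R N) (v : 'I_n -> 'cV[R]_N)
    (T Dv : 'I_n -> 'cV[R]_N) mu :
  (forall nu, Dv nu = c *: (\sum_rho h nu rho *: T rho)
                      - \sum_lam Gam mu lam nu *: v lam) ->
  \sum_nu wedge y (wedge (vec (Dv nu)) (z nu)) =
  c *: (\sum_rho wedge y (wedge (vec (T rho)) (\sum_nu h nu rho *: z nu)))
  - \sum_lam wedge y (wedge (vec (v lam)) (Gz mu lam)).
Proof.
move=> DvE; pose W u a := wedge y (wedge (vec u) a).
have WZ b u a : W (b *: u) a = b *: W u a by rewrite /W vecZ wedgeZl wedgeZr.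
have WZr b u a : W u (b *: a) = b *: W u a by rewrite /W !wedgeZr.
have Wsum (F : 'I_n -> _) a : W (\sum_t F t) a = \sum_t W (F t) a.
  by rewrite /W vec_sum wedge_suml wedge_sumr.
have Wsumr (F : 'I_n -> _) u : W u (\sum_t F t) = \sum_t W u (F t).
  by rewrite /W !wedge_sumr.
have WB u u' a : W (u - u') a = W u a - W u' a.
  by rewrite /W -scaleN1r vecD vecZ wedgeDl wedgeDr wedgeZl wedgeZr scaleN1r.
transitivity (\sum_nu (c *: (\sum_rho h nu rho *: W (T rho) (z nu))
                       - \sum_lam Gam mu lam nu *: W (v lam) (z nu))).
  apply: eq_bigr => nu _; rewrite DvE -/(W _ _) WB WZ !Wsum.
  by congr (_ *: _ - _); apply: eq_bigr => t _; rewrite WZ.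
rewrite sumrB -scaler_sumr; congr (_ *: _ - _); rewrite exchange_big;
  apply: eq_bigr => t _; rewrite -/(W _ _) Wsumr;
  by apply: eq_bigr => s _; rewrite WZr.
Qed.

(* In an arbitrary frame e_mu: h is the matrix g^{mu nu}, nabla_mu e_nu is the sum
   of the Gam mu nu lam e_lam, z nu = D_nu w, zz mu nu = D_mu D_nu w,
   u nu = gamma^nu phi, Du mu nu = D_mu(gamma^nu phi), and similarly v, Dv for psi. *)
Lemma sum_covariant_commutator (u v : 'I_n -> 'cV[R]_N)
    (Du Dv Tu Tv : 'I_n -> 'I_n -> 'cV[R]_N) (zz k : 'I_n -> 'I_n -> ext R N) :
  (forall mu nu, Du mu nu = c *: (\sum_rho h nu rho *: Tu mu rho)
                            - \sum_lam Gam mu lam nu *: u lam) ->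
  (forall mu nu, Dv mu nu = c *: (\sum_rho h nu rho *: Tv mu rho)
                            - \sum_lam Gam mu lam nu *: v lam) ->
  (forall mu nu, zz mu nu - zz nu mu = k mu nu + (Gz mu nu - Gz nu mu)) ->
  \sum_mu \sum_nu wedge (vec (u mu))
     (wedge (vec (Dv mu nu)) (z nu) + wedge (vec (v nu)) (zz mu nu)) +
  \sum_mu \sum_nu wedge (vec (v mu))
     (wedge (vec (Du mu nu)) (z nu) + wedge (vec (u nu)) (zz mu nu)) =
  \sum_mu \sum_nu wedge (wedge (vec (u mu)) (vec (v nu))) (k mu nu) +
  c *: (\sum_mu \sum_nu
    wedge (wedge (vec (u mu)) (vec (Tv mu nu)) +
           wedge (vec (v mu)) (vec (Tu mu nu))) (\sum_rho h rho nu *: z rho)).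
Proof.
move=> DuE DvE zzE.
pose a x y (w : ext R N) := wedge (vec x) (wedge (vec y) w).
pose hz nu := \sum_rho h rho nu *: z rho.
have aD x y w w' : a x y (w + w') = a x y w + a x y w' by rewrite /a !wedgeDr.
have aB x y w w' : a x y (w - w') = a x y w - a x y w'.
  by rewrite aD /a !wedgeNr.
have E x y (Dy Ty : 'I_n -> 'I_n -> 'cV[R]_N) :
    (forall mu nu, Dy mu nu = c *: (\sum_rho h nu rho *: Ty mu rho)
                              - \sum_lam Gam mu lam nu *: y lam) ->
    \sum_mu \sum_nu wedge (vec (x mu))
       (wedge (vec (Dy mu nu)) (z nu) + wedge (vec (y nu)) (zz mu nu)) =
    \sum_mu \sum_nu (c *: a (x mu) (Ty mu nu) (hz nu)
       - a (x mu) (y nu) (Gz mu nu) + a (x mu) (y nu) (zz mu nu)).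
  move=> DyE; apply: eq_bigr => mu _.
  under eq_bigr do rewrite wedgeDr.
  by rewrite big_split (sum_wedge_covariant _ (DyE mu)) big_split sumrB -scaler_sumr.
rewrite (E u v Dv Tv) // (E v u Du Tu) // {E}.
pose A mu nu := c *: a (u mu) (Tv mu nu) (hz nu) + c *: a (v mu) (Tu mu nu) (hz nu).
pose B mu nu := a (u mu) (v nu) (zz mu nu - Gz mu nu).
(* The torsion-free part of the second sum becomes - s nu mu after one exchange of v and u;
   relabelling mu and nu then sets it against [B], so that second derivatives enter
   antisymmetrized. *)
pose s mu nu := a (u mu) (v nu) (zz nu mu - Gz nu mu).
transitivity (\sum_mu \sum_nu (A mu nu + B mu nu - s nu mu)).
  rewrite -big_split; apply: eq_bigr => mu _.
  rewrite -big_split; apply: eq_bigr => nu _ /=.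
  rewrite /s [a (u nu) _ _]vec_wedgeC opprK -/(a _ _ _) /A /B !aB.
  by rewrite (AC (3*3) ((1*4)*(3*2)*(6*5)))%AC.
transitivity (\sum_mu \sum_nu (A mu nu + B mu nu - s mu nu)).
  have S2 (X : 'I_n -> 'I_n -> ext R N) (Y : 'I_n -> 'I_n -> ext R N) :
      \sum_mu \sum_nu (X mu nu - Y mu nu) =
      \sum_mu \sum_nu X mu nu - \sum_mu \sum_nu Y mu nu.
    by rewrite -sumrB; apply: eq_bigr => mu _; rewrite sumrB.
  by rewrite !S2 [in X in _ - X = _]exchange_big.
rewrite scaler_sumr -big_split; apply: eq_bigr => mu _.
rewrite scaler_sumr -big_split; apply: eq_bigr => nu _ /=.
have e : zz mu nu - Gz mu nu - (zz nu mu - Gz nu mu) = k mu nu.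
  by rewrite opprB [LHS](AC (2*2) ((1*4)*(3*2)))%AC /= zzE [k _ _ + _]addrA subrKA addrK.
rewrite /s /B -addrA -aB e wedgeDl -!wedgeA -!/(a _ _ _) scalerDr.
by rewrite [RHS]addrC.
Qed.

End ConnectionAlgebra.

From mathcomp Require Import all_classical all_reals all_analysis.
Import numFieldNormedType.Exports.
Local Open Scope classical_set_scope.

(** * Smooth functions and tangent vectors *)

Section NearDerivative.
Variables (R : realType) (n : nat).
Implicit Types (O : set 'rV[R]_n) (f h : 'rV[R]_n -> R^o).

(** The first-order expansion of f at x is also one of h, and [diff_unique] identifies the two
    differentials. *)
Lemma near_differentiable f h x : differentiable f x ->
  (\forall y \near x, f y = h y) ->
  differentiable h x /\ forall v, 'D_v h x = 'D_v f x.
Proof.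
move=> df fh; have [cf ef] := (diff_locallyP _ _).1 df.
have E : h \o shift x = cst (h x) + 'd f x +o_ (0 : 'rV[R]_n) id.
  apply/eqaddoP => e e0; have /eqaddoP/(_ e e0) := ef.
  apply: filter_app; move: (fh); rewrite (near_shift 0) subr0 => fh0.
  apply: filterS fh0 => y /= fhy; rewrite -(nbhs_singleton fh) /=.
  by rewrite !fctE /= fhy.
have U := diff_unique cf E.
have dh : differentiable h x by apply/diff_locallyP; rewrite U.
by split=> // v; rewrite !deriveE // U.
Qed.

Lemma times_differentiable_sub k O O' f : O' `<=` O ->
  times_differentiable k O f -> times_differentiable k O' f.
Proof.
move=> s; elim: k f => [|k IH] f /= [df Df]; split=> //; try by move=> x /s /df.
by move=> v; exact: IH.
Qed.

Lemma times_differentiableW k O f :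
  times_differentiable k.+1 O f -> times_differentiable k O f.
Proof.
by elim: k f => [|k IH] f [df Df]; split=> // v; apply: IH; exact: Df.
Qed.

Lemma times_differentiable_eq k O f h : open O -> {in O, f =1 h} ->
  times_differentiable k O f -> times_differentiable k O h.
Proof.
move=> oO.
have D f1 f2 : {in O, f1 =1 f2} -> (forall x, O x -> differentiable f1 x) ->
    forall x, O x -> differentiable f2 x /\ forall v, 'D_v f2 x = 'D_v f1 x.
  move=> e df x Ox; apply: near_differentiable; first exact: df.
  by apply: filterS (open_nbhs_nbhs (conj oO Ox)) => y Oy; apply: e; rewrite inE.
elim: k f h => [|k IH] f h e /= [/(D _ _ e) dh Df]; split=> [x /dh[]//|].
  by [].
by move=> v; apply: IH (Df v) => x; rewrite inE => /dh[_ ->].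
Qed.

Lemma times_differentiable_cst k O c :
  times_differentiable k O (cst c : 'rV[R]_n -> R^o).
Proof.
elim: k c => [|k IH] c; split=> // v.
have -> : 'D_v (cst c) = cst 0 by apply/funext => x; rewrite derive_cst.
exact: IH.
Qed.

Lemma times_differentiableD k O f h : open O ->
  times_differentiable k O f -> times_differentiable k O h ->
  times_differentiable k O (f + h).
Proof.
move=> oO; elim: k f h => [|k IH] f h [df Df] [dh Dh]; split=> //.
1,2: by move=> x Ox; apply: differentiableD; [exact: df|exact: dh].
move=> v; apply: times_differentiable_eq (IH _ _ (Df v) (Dh v)) => // x.
by rewrite inE => Ox; rewrite deriveD //; apply: diff_derivable; [exact: df|exact: dh].
Qed.

(** The derivative of the product contains f and h undifferentiated; [times_differentiableW]
    supplies them at the order of the induction hypothesis. *)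
Lemma times_differentiableM k O f h : open O ->
  times_differentiable k O f -> times_differentiable k O h ->
  times_differentiable k O (f * h).
Proof.
move=> oO; elim: k f h => [|k IH] f h Tf Th; have [df Df] := Tf; have [dh Dh] := Th;
  split=> //.
1,2: by move=> x Ox; apply: differentiableM; [exact: df|exact: dh].
move=> v; apply: times_differentiable_eq (times_differentiableD oO
   (IH _ _ (times_differentiableW Tf) (Dh v))
   (IH _ _ (times_differentiableW Th) (Df v))) => // x.
by rewrite inE => Ox; rewrite deriveM //; apply: diff_derivable; [exact: df|exact: dh].
Qed.

(** The derivative of 1/f is - (1/f) (1/f) D_v f, so order k for 1/f yields order k + 1. *)
Lemma times_differentiableV k O f : open O -> (forall x, O x -> f x != 0) ->
  times_differentiable k O f ->
  times_differentiable k O (fun x => (f x)^-1).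
Proof.
move=> oO f0; elim: k => [|k IH] Tf; have [df Df] := Tf; split=> //.
1,2: by move=> x Ox; apply: differentiableV; [exact: df|exact: f0].
move=> v; have Ti := IH (times_differentiableW Tf).
apply: times_differentiable_eq (times_differentiableM oO
  (times_differentiable_cst k O (-1))
  (times_differentiableM oO (times_differentiableM oO Ti Ti) (Df v))) => // x.
rewrite inE => Ox; rewrite deriveV ?f0 //; last by apply: diff_derivable; exact: df.
rewrite !fctE /= /GRing.scale /= mulN1r mulNr; congr (- (_ * _)).
by rewrite -expr2 exprVn.
Qed.

End NearDerivative.

Section SmoothFunctions.
Variables (R : realType) (n : nat) (M : manifold R n).
Implicit Types (U V W : set M) (f h : M -> R) (X Y : vfield M) (x : M).

Lemma chart_image_open (a : atlas M) U :
  open U -> open (chart a @` (cdom a `&` U)).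
Proof.
move=> oU.
have -> : chart a @` (cdom a `&` U) =
    chart a @` cdom a `&` chart_inv a @^-1` U.
  apply/seteqP; split=> y [].
    by move=> z [az Uz] <-; split; [exists z|rewrite /= chartK ?inE].
  by move=> [z az <-] /=; rewrite chartK ?inE // => Uz; exists z.
rewrite openE => y [Oy Uy]; apply: filterI.
  by apply: open_nbhs_nbhs; split=> //; exact: chart_img_open.
by apply: (chart_inv_cont Oy); exact: open_nbhs_nbhs.
Qed.

Lemma smooth_on_sub U V f : V `<=` U -> smooth_on U f -> smooth_on V f.
Proof.
move=> VU sf a k; apply: times_differentiable_sub (sf a k).
by apply: image_subset => y [ay /VU].
Qed.

Lemma smooth_on_eq U f h :
  open U -> (forall x, U x -> f x = h x) -> smooth_on U f -> smooth_on U h.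
Proof.
move=> oU e sf a k; apply: times_differentiable_eq (sf a k).
  exact: chart_image_open.
by move=> y; rewrite inE => -[z [az Uz] <-]; rewrite chartK ?inE // e.
Qed.

Lemma smooth_on_cst U c : smooth_on U (fun _ => c).
Proof. by move=> a k; exact: times_differentiable_cst. Qed.

Lemma smooth_onD U f h : open U -> smooth_on U f -> smooth_on U h ->
  smooth_on U (fun x => f x + h x).
Proof.
move=> oU sf sh a k.
by apply: times_differentiableD (sf a k) (sh a k); exact: chart_image_open.
Qed.

Lemma smooth_onM U f h : open U -> smooth_on U f -> smooth_on U h ->
  smooth_on U (fun x => f x * h x).
Proof.
move=> oU sf sh a k.
by apply: times_differentiableM (sf a k) (sh a k); exact: chart_image_open.
Qed.

Lemma smooth_onV U f : open U -> (forall x, U x -> f x != 0) ->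
  smooth_on U f -> smooth_on U (fun x => (f x)^-1).
Proof.
move=> oU f0 sf a k; apply: times_differentiableV (sf a k).
  exact: chart_image_open.
by move=> y [z [az Uz] <-]; rewrite chartK ?inE // f0.
Qed.

Lemma smooth_on_sum U (T : Type) (r : seq T) (P : pred T) (F : T -> M -> R) :
  open U -> (forall t, P t -> smooth_on U (F t)) ->
  smooth_on U (fun x => \sum_(t <- r | P t) F t x).
Proof.
move=> oU sF; elim: r => [|t r IH].
  by apply: smooth_on_eq (smooth_on_cst U 0) => // x _; rewrite big_nil.
case Pt: (P t).
  apply: smooth_on_eq (smooth_onD oU (sF t Pt) IH) => // x _.
  by rewrite big_cons Pt.
by apply: smooth_on_eq IH => // x _; rewrite big_cons Pt.
Qed.

Lemma smooth_on_prod U (T : Type) (r : seq T) (P : pred T) (F : T -> M -> R) :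
  open U -> (forall t, P t -> smooth_on U (F t)) ->
  smooth_on U (fun x => \prod_(t <- r | P t) F t x).
Proof.
move=> oU sF; elim: r => [|t r IH].
  by apply: smooth_on_eq (smooth_on_cst U 1) => // x _; rewrite big_nil.
case Pt: (P t).
  apply: smooth_on_eq (smooth_onM oU (sF t Pt) IH) => // x _.
  by rewrite big_cons Pt.
by apply: smooth_on_eq IH => // x _; rewrite big_cons Pt.
Qed.

Lemma smooth_on_det U m (F : M -> 'M[R]_m) :
  open U -> (forall i j, smooth_on U (fun x => F x i j)) ->
  smooth_on U (fun x => \det (F x)).
Proof.
move=> oU sF; rewrite /determinant; apply: smooth_on_sum => // s _.
apply: smooth_onM => //; first exact: smooth_on_cst.
by apply: smooth_on_prod.
Qed.

(** Cramer's rule: cofactors and the determinant are polynomial in the entries. *)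
Lemma smooth_on_invmx U m (F : M -> 'M[R]_m) :
  open U -> (forall x, U x -> F x \in unitmx) ->
  (forall i j, smooth_on U (fun x => F x i j)) ->
  forall i j, smooth_on U (fun x => invmx (F x) i j).
Proof.
move=> oU uF sF i j.
have sadj : smooth_on U (fun x => (\adj (F x)) i j).
  apply: (@smooth_on_eq _ (fun x => cofactor (F x) j i)) => //.
    by move=> x _; rewrite mxE.
  rewrite /cofactor; apply: smooth_onM => //; first exact: smooth_on_cst.
  apply: smooth_on_det => // k l.
  by apply: smooth_on_eq (sF (lift j k) (lift i l)) => // x _; rewrite !mxE.
apply: (smooth_on_eq oU _
  (smooth_onM oU (smooth_onV oU _ (smooth_on_det oU sF)) sadj)).
  by move=> x Ux; rewrite /invmx uF //= [RHS]mxE.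
by move=> x Ux; move: (uF x Ux); rewrite unitmxE unitfE.
Qed.

Section Tangent.
Variables (x : M) (v : tspace x) (U : set M).
Hypotheses (oU : open U) (Ux : U x).

Lemma smooth_on_at f : smooth_on U f -> smooth_at x f.
Proof. by exists U. Qed.

Lemma tangentP : is_tangent x v.
Proof. by case: v => w /= /asboolP. Qed.

Lemma tangentD f h : smooth_on U f -> smooth_on U h ->
  v (fun y => f y + h y) = v f + v h.
Proof.
move=> /smooth_on_at sf /smooth_on_at sh; have [L _ _ _] := tangentP.
rewrite -[v f]mul1r -L //; congr (v _); apply/funext => y.
by rewrite mul1r.
Qed.

Lemma tangentM f h : smooth_on U f -> smooth_on U h ->
  v (fun y => f y * h y) = v f * h x + f x * v h.
Proof.
by have [_ L _ _] := tangentP; move=> /smooth_on_at sf /smooth_on_at /(L _ _ sf).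
Qed.

Lemma tangent_cst c : v (fun _ => c) = 0.
Proof.
have [L P _ _] := tangentP.
have s d : smooth_at x (fun _ => d) by exact: smooth_on_at (smooth_on_cst U d).
have v1 : v (fun _ => 1) = 0.
  have := P _ _ (s 1) (s 1); rewrite !mulr1 mul1r => /eqP.
  by rewrite -subr_eq subrr eq_sym => /eqP.
have v0 : v (fun _ => 0) = 0.
  by have := P _ _ (s 0) (s 0); rewrite !mulr0 mul0r addr0.
by have := L c _ _ (s 1) (s 0); rewrite v1 v0 mulr0 !addr0 mulr1.
Qed.

Lemma tangent_eq f h : (forall y, U y -> f y = h y) -> smooth_on U f ->
  v f = v h.
Proof.
move=> e sf; have [_ _ L _] := tangentP; apply: L.
- exact: smooth_on_at.
- exact/smooth_on_at/(smooth_on_eq oU e).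
- by apply: filterS (open_nbhs_nbhs (conj oU Ux)).
Qed.

Lemma tangent_sum (T : Type) (r : seq T) (P : pred T) (F : T -> M -> R) :
  (forall t, P t -> smooth_on U (F t)) ->
  v (fun y => \sum_(t <- r | P t) F t y) = \sum_(t <- r | P t) v (F t).
Proof.
move=> sF; elim: r => [|t r IH].
  by rewrite big_nil; under eq_fun do rewrite big_nil; exact: tangent_cst.
rewrite big_cons; under eq_fun do rewrite big_cons.
case Pt: (P t) => //; rewrite tangentD ?IH //; first exact: sF.
exact: smooth_on_sum.
Qed.

End Tangent.

Lemma vsmooth_sub U V X : V `<=` U -> vsmooth U X -> vsmooth V X.
Proof. by move=> VU sX W f oW WV; apply: sX => // y /WV /VU. Qed.

(** [lie_bracket] takes the default 0 unless the commutator is a tangent vector, so [tB] must first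
    show that it is a derivation of germs. *)
Lemma lie_bracketE U X Y x f : open U -> U x -> vsmooth U X -> vsmooth U Y ->
  smooth_on U f ->
  lie_bracket X Y x f = X x (fun y => Y y f) - Y x (fun y => X y f).
Proof.
move=> oU Ux sX sY sf.
rewrite /lie_bracket /insubd.
set B := (fun f0 => _).
have tB : B \in tangent_pred x.
  apply/asboolP; rewrite /B.
  (* The inner function y -> Z y a is controlled only where a is smooth, so both arguments are
     restricted to a common V inside U. *)
  have com a b : smooth_at x a -> smooth_at x b -> exists V,
     [/\ open V, V x, V `<=` U, smooth_on V a & smooth_on V b].
    move=> [A [oA Ax sa]] [A' [oA' A'x sb]]; exists (U `&` A `&` A').
    split; [by apply: openI => //; exact: openI|by []|by move=> y [[]]| |].
    - by apply: smooth_on_sub sa => y [[]].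
    - by apply: smooth_on_sub sb => y [[]].
  have sm V a Z : open V -> V `<=` U -> vsmooth U Z -> smooth_on V a ->
      smooth_on V (fun y => Z y a).
    by move=> oV VU sZ; exact: sZ.
  split=> [c a b sa sb|a b sa sb|a b sa sb e|a nsa].
  - have [V [oV Vx VU sVa sVb]] := com _ _ sa sb.
    have sVca := smooth_onM oV (smooth_on_cst V c) sVa.
    rewrite !asboolT //; last exact: smooth_on_at (smooth_onD oV sVca sVb).
    have E Z : vsmooth U Z -> forall y, V y ->
        c * Z y a + Z y b = Z y (fun y => c * a y + b y).
      move=> sZ y Vy; rewrite (tangentD _ oV Vy) // (tangentM _ oV Vy) //.
        by rewrite (tangent_cst _ oV Vy) mul0r add0r.
      exact: smooth_on_cst.
    have F Z Z' : vsmooth U Z -> vsmooth U Z' ->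
        Z' x (fun y => Z y (fun y => c * a y + b y)) =
        c * Z' x (fun y => Z y a) + Z' x (fun y => Z y b).
      move=> sZ sZ'; have sZa := sm _ _ _ oV VU sZ sVa.
      have sZb := sm _ _ _ oV VU sZ sVb.
      have scZa := smooth_onM oV (smooth_on_cst V c) sZa.
      rewrite -(tangent_eq (Z' x) oV Vx (E Z sZ)); last exact: smooth_onD.
      rewrite (tangentD _ oV Vx) // (tangentM _ oV Vx) //; last exact: smooth_on_cst.
      by rewrite (tangent_cst _ oV Vx) mul0r add0r.
    by rewrite !F // mulrBr addrACA opprD.
  - have [V [oV Vx VU sVa sVb]] := com _ _ sa sb.
    rewrite !asboolT //; last exact: smooth_on_at (smooth_onM oV sVa sVb).
    have E Z : vsmooth U Z -> forall y, V y ->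
        Z y a * b y + a y * Z y b = Z y (fun y => a y * b y).
      by move=> sZ y Vy; rewrite (tangentM _ oV Vy).
    (* The two products of first derivatives are together symmetric in Z and Z' and cancel in the
       bracket. *)
    have F Z Z' : vsmooth U Z -> vsmooth U Z' ->
        Z' x (fun y => Z y (fun y => a y * b y)) =
        Z' x (fun y => Z y a) * b x + Z x a * Z' x b +
        (Z' x a * Z x b + a x * Z' x (fun y => Z y b)).
      move=> sZ sZ'; have sZa := sm _ _ _ oV VU sZ sVa.
      have sZb := sm _ _ _ oV VU sZ sVb.
      have s1 := smooth_onM oV sZa sVb; have s2 := smooth_onM oV sVa sZb.
      rewrite -(tangent_eq (Z' x) oV Vx (E Z sZ)); last exact: smooth_onD.
      by rewrite (tangentD _ oV Vx) // !(tangentM _ oV Vx).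
    rewrite !F //; ring.
  - have [V [oV Vx VU sVa sVb]] := com _ _ sa sb.
    rewrite !asboolT //.
    (* An open set of agreement is extracted so that Z y a = Z y b at every y in it, not only at x;
       the outer derivative needs this. *)
    have := e; rewrite /prop_near1 nbhsE => -[W [oW Wx] We].
    have oVW := openI oV oW; have VWx : (V `&` W) x by [].
    have VWV : V `&` W `<=` V by move=> y [].
    have sa' := smooth_on_sub VWV sVa.
    have E Z : vsmooth U Z -> forall y, (V `&` W) y -> Z y a = Z y b.
      by move=> _ y VWy; apply: (tangent_eq _ oVW VWy) sa' => z [_ /We].
    have F Z (Z' : vfield M) : vsmooth U Z ->
        Z' x (fun y => Z y a) = Z' x (fun y => Z y b).
      move=> sZ; apply: (tangent_eq (Z' x) oVW VWx (E Z sZ)).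
      by apply: (sm _ _ _ oVW) => // y /VWV /VU.
    by rewrite !(F X Y) // (F Y X).
  - by rewrite asboolF.
rewrite insubT /= /B asboolT //; exact: smooth_on_at sf.
Qed.

End SmoothFunctions.

(** * Calculus of functions valued in matrices and in the exterior algebra *)

Section MatrixValuedFunctions.
Variables (R : realType) (n : nat) (M : manifold R n).
Implicit Types (U : set M).

Definition mxsmooth U m k (F : M -> 'M[R]_(m, k)) :=
  forall i j, smooth_on U (fun y => F y i j).

Definition extsmooth U N (w : M -> ext R N) :=
  forall I, smooth_on U (fun y => w y I).

(** Extends [dspinor] to all matrix sizes, so that spinors, Gram matrices and connection matrices
    share one set of rules. *)
Definition dmx x (v : tspace x) m k (F : M -> 'M[R]_(m, k)) : 'M[R]_(m, k) :=
  \matrix_(i, j) v (fun y => F y i j).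

Lemma dspinorE N x (v : tspace x) (u : M -> 'cV[R]_N) : dspinor v u = dmx v u.
Proof. by apply/colP => k; rewrite !mxE. Qed.

Lemma mxsmoothD U m k (F H : M -> 'M[R]_(m, k)) : open U ->
  mxsmooth U F -> mxsmooth U H -> mxsmooth U (fun y => F y + H y).
Proof.
move=> oU sF sH i j.
by apply: smooth_on_eq (smooth_onD oU (sF i j) (sH i j)) => // y _; rewrite mxE.
Qed.

Lemma mxsmoothM U m k l (F : M -> 'M[R]_(m, k)) (H : M -> 'M[R]_(k, l)) :
  open U -> mxsmooth U F -> mxsmooth U H -> mxsmooth U (fun y => F y *m H y).
Proof.
move=> oU sF sH i j.
apply: (@smooth_on_eq _ _ _ _ (fun y => \sum_t F y i t * H y t j)) => //.
  by move=> y _; rewrite mxE.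
by apply: smooth_on_sum => // t _; exact: smooth_onM.
Qed.

Lemma mxsmoothZ U m k (f : M -> R) (F : M -> 'M[R]_(m, k)) : open U ->
  smooth_on U f -> mxsmooth U F -> mxsmooth U (fun y => f y *: F y).
Proof.
move=> oU sf sF i j.
by apply: smooth_on_eq (smooth_onM oU sf (sF i j)) => // y _; rewrite mxE.
Qed.

Lemma mxsmooth_sum U m k (T : Type) (r : seq T) (P : pred T)
    (F : T -> M -> 'M[R]_(m, k)) : open U ->
  (forall t, P t -> mxsmooth U (F t)) ->
  mxsmooth U (fun y => \sum_(t <- r | P t) F t y).
Proof.
move=> oU sF i j.
apply: (@smooth_on_eq _ _ _ _ (fun y => \sum_(t <- r | P t) F t y i j)) => //.
  by move=> y _; rewrite summxE.
by apply: smooth_on_sum => // t /sF; apply.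
Qed.

Lemma mxsmooth_cst U m k (F : 'M[R]_(m, k)) : mxsmooth U (fun _ => F).
Proof. by move=> i j; exact: smooth_on_cst. Qed.

Lemma extsmoothD U N (w z : M -> ext R N) : open U ->
  extsmooth U w -> extsmooth U z -> extsmooth U (fun y => w y + z y).
Proof.
move=> oU sw sz I.
by apply: smooth_on_eq (smooth_onD oU (sw I) (sz I)) => // y _; rewrite ffunE.
Qed.

Lemma extsmooth_wedge U N (w z : M -> ext R N) : open U ->
  extsmooth U w -> extsmooth U z -> extsmooth U (fun y => wedge (w y) (z y)).
Proof.
move=> oU sw sz K.
apply: (@smooth_on_eq _ _ _ _ (fun y => \sum_(I : {set 'I_N} | I \subset K)
     shuffle_sign R I (K :\: I) * w y I * z y (K :\: I))) => //.
  by move=> y _; rewrite ffunE.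
apply: smooth_on_sum => // I _; apply: smooth_onM => //; apply: smooth_onM => //.
exact: smooth_on_cst.
Qed.

Lemma extsmooth_sum U N (T : Type) (r : seq T) (P : pred T)
    (w : T -> M -> ext R N) : open U ->
  (forall t, P t -> extsmooth U (w t)) ->
  extsmooth U (fun y => \sum_(t <- r | P t) w t y).
Proof.
move=> oU sw I.
apply: (@smooth_on_eq _ _ _ _ (fun y => \sum_(t <- r | P t) w t y I)) => //.
  by move=> y _; rewrite sum_ffunE.
by apply: smooth_on_sum => // t /sw; apply.
Qed.

Lemma extsmooth_vec U N (u : M -> 'cV[R]_N) : open U ->
  mxsmooth U u -> extsmooth U (fun y => vec (u y)).
Proof.
move=> oU su I.
apply: (@smooth_on_eq _ _ _ _ (fun y => \sum_k u y k 0 * (I == [set k]%SET)%:R)) => //.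
  by move=> y _; rewrite ffunE; apply: eq_bigr => k _; rewrite mulr_natr.
apply: smooth_on_sum => // k _; apply: smooth_onM => //; exact: smooth_on_cst.
Qed.

Lemma extsmooth_contract U N k (w : M -> ext R N) : open U ->
  extsmooth U w -> extsmooth U (fun y => Defs.contract k (w y)).
Proof.
move=> oU sw I; case kI: (k \in I).
  by apply: smooth_on_eq (smooth_on_cst U 0) => // y _; rewrite ffunE kI.
apply: smooth_on_eq (smooth_onM oU
  (smooth_on_cst U (shuffle_sign R [set k]%SET I)) (sw (k |: I)%SET)) => // y _.
by rewrite ffunE kI.
Qed.

Lemma mxsmooth_col U m k (F : M -> 'M[R]_(m, k)) j : open U ->
  mxsmooth U F -> mxsmooth U (fun y => col j (F y)).
Proof.
by move=> oU sF i l; apply: smooth_on_eq (sF i j) => // y _; rewrite mxE.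
Qed.

Lemma extsmooth_der U N (F : M -> 'M[R]_N) (w : M -> ext R N) : open U ->
  mxsmooth U F -> extsmooth U w -> extsmooth U (fun y => der (F y) (w y)).
Proof.
move=> oU sF sw; apply: extsmooth_sum => // k _; apply: extsmooth_wedge => //.
  by apply: extsmooth_vec => //; exact: mxsmooth_col.
exact: extsmooth_contract.
Qed.

Lemma extsmooth_dext U N X (w : M -> ext R N) : open U -> vsmooth U X ->
  extsmooth U w -> extsmooth U (fun y => dext (X y) w).
Proof.
move=> oU sX sw I.
by apply: smooth_on_eq (sX U _ oU _ (sw I)) => // y _; rewrite ffunE.
Qed.

Section PointDerivative.
Variables (x : M) (v : tspace x) (U : set M).
Hypotheses (oU : open U) (Ux : U x).

Lemma dmxM m k l (F : M -> 'M[R]_(m, k)) (H : M -> 'M[R]_(k, l)) :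
  mxsmooth U F -> mxsmooth U H ->
  dmx v (fun y => F y *m H y) = dmx v F *m H x + F x *m dmx v H.
Proof.
move=> sF sH; apply/matrixP => i j; rewrite !mxE -big_split.
transitivity (v (fun y => \sum_t F y i t * H y t j)).
  by congr (v _); apply/funext => y; rewrite mxE.
rewrite (tangent_sum v oU Ux) => [|t _]; last exact: smooth_onM.
by apply: eq_bigr => t _; rewrite (tangentM v oU Ux) // !mxE.
Qed.

Lemma dmxZ m k (f : M -> R) (F : M -> 'M[R]_(m, k)) :
  smooth_on U f -> mxsmooth U F ->
  dmx v (fun y => f y *: F y) = v f *: F x + f x *: dmx v F.
Proof.
move=> sf sF; apply/matrixP => i j; rewrite !mxE -(tangentM v oU Ux) //.
by congr (v _); apply/funext => y; rewrite mxE.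
Qed.

Lemma dmx_sum m k (T : Type) (r : seq T) (P : pred T)
    (F : T -> M -> 'M[R]_(m, k)) : (forall t, P t -> mxsmooth U (F t)) ->
  dmx v (fun y => \sum_(t <- r | P t) F t y) = \sum_(t <- r | P t) dmx v (F t).
Proof.
move=> sF; apply/matrixP => i j; rewrite !mxE summxE.
transitivity (v (fun y => \sum_(t <- r | P t) F t y i j)).
  by congr (v _); apply/funext => y; rewrite summxE.
rewrite (tangent_sum v oU Ux) => [|t /sF]; last by apply.
by apply: eq_bigr => t _; rewrite mxE.
Qed.

Lemma dextD N (w z : M -> ext R N) : extsmooth U w -> extsmooth U z ->
  dext v (fun y => w y + z y) = dext v w + dext v z.
Proof.
move=> sw sz; apply/ffunP => I; rewrite !ffunE -(tangentD v oU Ux) //.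
by congr (v _); apply/funext => y; rewrite ffunE.
Qed.

Lemma dext_sum N (T : Type) (r : seq T) (P : pred T) (w : T -> M -> ext R N) :
  (forall t, P t -> extsmooth U (w t)) ->
  dext v (fun y => \sum_(t <- r | P t) w t y) = \sum_(t <- r | P t) dext v (w t).
Proof.
move=> sw; apply/ffunP => I; rewrite ffunE sum_ffunE.
transitivity (v (fun y => \sum_(t <- r | P t) w t y I)).
  by congr (v _); apply/funext => y; rewrite sum_ffunE.
rewrite (tangent_sum v oU Ux) => [|t /sw]; last by apply.
by apply: eq_bigr => t _; rewrite ffunE.
Qed.

Lemma dext_wedge N (w z : M -> ext R N) : extsmooth U w -> extsmooth U z ->
  dext v (fun y => wedge (w y) (z y)) =
  wedge (dext v w) (z x) + wedge (w x) (dext v z).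
Proof.
move=> sw sz; apply/ffunP => K; rewrite !ffunE -big_split.
transitivity (v (fun y => \sum_(I : {set 'I_N} | I \subset K)
     shuffle_sign R I (K :\: I) * w y I * z y (K :\: I))).
  by congr (v _); apply/funext => y; rewrite ffunE.
rewrite (tangent_sum v oU Ux) => [|I _]; last first.
  apply: smooth_onM => //; apply: smooth_onM => //; exact: smooth_on_cst.
apply: eq_bigr => I _.
have sc := smooth_on_cst U (shuffle_sign R I (K :\: I)).
rewrite (tangentM v oU Ux) //; last exact: smooth_onM.
by rewrite (tangentM v oU Ux) // (tangent_cst v oU Ux) mul0r add0r !ffunE.
Qed.

Lemma dext_vec N (u : M -> 'cV[R]_N) : mxsmooth U u ->
  dext v (fun y => vec (u y)) = vec (dmx v u).
Proof.
move=> su; apply/ffunP => I; rewrite !ffunE.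
transitivity (v (fun y => \sum_k u y k 0 * (I == [set k]%SET)%:R)).
  congr (v _); apply/funext => y; rewrite ffunE.
  by apply: eq_bigr => k _; rewrite mulr_natr.
rewrite (tangent_sum v oU Ux) => [|k _]; last first.
  by apply: smooth_onM => //; exact: smooth_on_cst.
apply: eq_bigr => k _; rewrite (tangentM v oU Ux) //; last exact: smooth_on_cst.
by rewrite (tangent_cst v oU Ux) mulr0 addr0 mxE mulr_natr.
Qed.

Lemma dext_contract N k (w : M -> ext R N) : extsmooth U w ->
  dext v (fun y => Defs.contract k (w y)) = Defs.contract k (dext v w).
Proof.
move=> sw; apply/ffunP => I; rewrite !ffunE; case kI: (k \in I).
  rewrite -[RHS](tangent_cst v oU Ux 0); congr (v _); apply/funext => y.
  by rewrite ffunE kI.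
set s := shuffle_sign _ _ _.
transitivity (v (fun y => s * w y (k |: I)%SET)).
  by congr (v _); apply/funext => y; rewrite ffunE kI.
rewrite (tangentM v oU Ux) //; last exact: smooth_on_cst.
by rewrite (tangent_cst v oU Ux) mul0r add0r.
Qed.

Lemma dext_der N (F : M -> 'M[R]_N) (w : M -> ext R N) :
  mxsmooth U F -> extsmooth U w ->
  dext v (fun y => der (F y) (w y)) =
  der (dmx v F) (w x) + der (F x) (dext v w).
Proof.
move=> sF sw.
have sv k := extsmooth_vec oU (mxsmooth_col k oU sF).
have sc k := extsmooth_contract k oU sw.
rewrite dext_sum => [|k _]; last exact: extsmooth_wedge.
rewrite -big_split; apply: eq_bigr => k _ /=.
rewrite dext_wedge // dext_contract // dext_vec; last exact: mxsmooth_col.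
congr (wedge (vec _) _ + _); apply/colP => l; rewrite !mxE.
by congr (v _); apply/funext => y; rewrite mxE.
Qed.

End PointDerivative.
End MatrixValuedFunctions.

(** * Frames and gauges *)

(** Linearity is a hypothesis because the metric, [conn] and [cliff] are plain functions of the
    tangent vector. The instance c = -1 at 0 gives f 0 = 0. *)
Lemma linear_sumZ (K : pzRingType) (V V' : lmodType K) (f : V -> V') (T : Type)
    (r : seq T) (a : T -> K) (F : T -> V) :
  (forall c u v, f (c *: u + v) = c *: f u + f v) ->
  f (\sum_(t <- r) a t *: F t) = \sum_(t <- r) a t *: f (F t).
Proof.
move=> fl; elim: r => [|t r IH]; last by rewrite !big_cons fl IH.
by rewrite !big_nil; have := fl (-1) 0 0; rewrite !scaleN1r oppr0 add0r addNr.
Qed.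

Section Frame.
Variables (R : realType) (n : nat) (M : manifold R n) (g : metric M).
Variables (U : set M) (b : 'I_n -> vfield M).
Hypotheses (oU : open U) (bU : frame_on U b).

Lemma met_linr x c (u v w : tspace x) :
  g x w (c *: u + v) = c * g x w u + g x w v.
Proof. by rewrite met_sym met_lin !(met_sym g w). Qed.

(** A row c in the kernel gives a vector orthogonal to the whole frame, hence zero by nondegeneracy;
    uniqueness of frame coefficients then gives c = 0. *)
Lemma gram_unit x : U x -> gram g b x \in unitmx.
Proof.
move=> Ux; have [_ bx] := bU; rewrite -row_free_unit -kermx_eq0.
apply/eqP/row_matrixP => k; rewrite row0.
set c := row k _.
have cG : c *m gram g b x = 0 by rewrite -row_mul mulmx_ker row0.
clearbody c.
have c0 : \sum_mu c 0 mu *: b mu x = 0.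
  apply: (@met_nondeg _ _ _ g) => w; have [a [-> _]] := bx x w Ux.
  rewrite (linear_sumZ (V' := R^o)); last by move=> *; exact: met_linr.
  rewrite big1 // => nu _.
  rewrite (linear_sumZ (V' := R^o) (f := fun u => g x u (b nu x))); last first.
    by move=> *; exact: met_lin.
  have /rowP/(_ nu) := cG; rewrite !mxE => e.
  rewrite [X in _ *: X](_ : _ = 0) ?scaler0 // -[RHS]e.
  by apply: eq_bigr => mu _; rewrite mxE.
have [a [_ ua]] := bx x 0 Ux; rewrite -(ua c) ?c0 // -(ua 0) //.
by rewrite big1 // => mu _; rewrite mxE scale0r.
Qed.

Lemma gram_tr x : (gram g b x)^T = gram g b x.
Proof. by apply/matrixP => k l; rewrite !mxE met_sym. Qed.

Lemma ginv_sym x k l : ginv g b x k l = ginv g b x l k.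
Proof. by rewrite /ginv -[in LHS]gram_tr -trmx_inv mxE. Qed.

Lemma mxsmooth_gram : mxsmooth U (gram g b).
Proof.
move=> k l; have [sb _] := bU.
by apply: smooth_on_eq (met_smooth g oU (sb k) (sb l)) => // y _; rewrite mxE.
Qed.

Lemma mxsmooth_ginv : mxsmooth U (ginv g b).
Proof.
by apply: smooth_on_invmx => //; [exact: gram_unit|exact: mxsmooth_gram].
Qed.

Variable nab : affine_connection M.
Hypothesis LC : levi_civita g nab.

Lemma vsmooth_on_at x X : U x -> vsmooth U X -> vsmooth_at x X.
Proof. by exists U. Qed.

(** Metric compatibility gives dG = Gam G + G Gam^T for the Gram matrix G. Differentiating G G^-1 =
    1 and multiplying by G^-1 on the left does the rest. *)
Lemma dmx_ginv x (v : tspace x) (Gam : 'M[R]_n) : U x ->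
  (forall rho, @nab x v (b rho) = \sum_s Gam rho s *: b s x) ->
  dmx v (ginv g b) = - (ginv g b x *m Gam) - Gam^T *m ginv g b x.
Proof.
move=> Ux GamE; have [sb _] := bU; have [_ comp _] := LC.
have dG : dmx v (gram g b) = Gam *m gram g b x + gram g b x *m Gam^T.
  apply/matrixP => r t; rewrite !mxE.
  have -> : (fun y => gram g b y r t) = (fun y => g y (b r y) (b t y)).
    by apply/funext => y; rewrite mxE.
  rewrite comp; [|exact: vsmooth_on_at Ux (sb _)..].
  rewrite !GamE (linear_sumZ (V' := R^o) (f := fun u => g x u (b t x))); last first.
    by move=> *; exact: met_lin.
  rewrite (linear_sumZ (V' := R^o)); last by move=> *; exact: met_linr.
  congr (_ + _); apply: eq_bigr => s _; rewrite !mxE //.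
  by rewrite [LHS]mulrC.
have uG := gram_unit Ux.
have E0 : dmx v (fun y => gram g b y *m ginv g b y) = 0.
  apply/matrixP => r t; rewrite !mxE.
  rewrite (tangent_eq v oU Ux (h := fun _ => (1%:M : 'M[R]_n) r t)).
  - exact: (tangent_cst v oU Ux).
  - by move=> y Uy; rewrite mulmxV // gram_unit.
  - exact: (mxsmoothM oU mxsmooth_gram mxsmooth_ginv).
rewrite (dmxM v oU Ux mxsmooth_gram mxsmooth_ginv) dG in E0.
have := congr1 (mulmx (ginv g b x)) E0.
rewrite mulmx0 mulmxDr [in X in _ + X]mulmxA mulVmx // mul1mx mulmxDl mulmxDr.
rewrite -!mulmxA mulmxV // mulmx1 !mulmxA mulVmx // mul1mx => e.
by rewrite -opprD; apply/eqP; rewrite -addr_eq0 addrC e.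
Qed.

End Frame.

(** * Leibniz rule and curvature of D in one gauge *)

Section LocalGauge.
Variables (R : realType) (n p N : nat) (M : manifold R n) (g : metric M)
  (G : clifford_module R n p N) (Sp : spin_structure g G)
  (nab : affine_connection M) (A : end_form Sp).
Hypotheses (LC : levi_civita g nab) (AA : is_end_form A).
Variables (W : set M) (i : gauge Sp).
Hypotheses (oW : open W) (Wi : W `<=` sdom i).

Definition conn x (v : tspace x) : 'M[R]_N := spin_form nab i v + A i x v.

Lemma sframe_smooth a : vsmooth W (sframe i a).
Proof.
by have [s _] := sframe_frame i; apply: vsmooth_sub (s a).
Qed.

Lemma conn_lin x : W x -> forall c (u v : tspace x),
  conn (c *: u + v) = c *: conn u + conn v.
Proof.
move=> Wx c u v; have [[nl _ _ _ _] _ _] := LC.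
rewrite /conn linearP scalerDr addrACA; congr (_ + _).
rewrite /spin_form scalerA [c * _]mulrC -scalerA -scalerDr; congr (_ *: _).
rewrite scaler_sumr -big_split; apply: eq_bigr => a _.
rewrite scaler_sumr -big_split; apply: eq_bigr => a' _ /=.
rewrite scalerA -scalerDl nl; last exact: vsmooth_on_at Wx (sframe_smooth a).
by rewrite met_lin; congr (_ *: _); ring.
Qed.

Lemma conn_smooth X : vsmooth W X -> mxsmooth W (fun y => conn (X y)).
Proof.
move=> sX; apply: mxsmoothD => //; last by case: AA => sA _; exact: sA.
have [[_ _ _ _ ns] _ _] := LC.
have sc (c : R) := smooth_on_cst W c.
apply: mxsmoothZ => //; apply: mxsmooth_sum => // a _.
apply: mxsmooth_sum => // a' _; apply: mxsmoothZ => //.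
apply: smooth_onM => //.
by apply: met_smooth => //; [apply: ns|]; rewrite //; exact: sframe_smooth.
Qed.

Lemma cliff_lin x c (u v : tspace x) :
  cliff g G (sframe i) (c *: u + v) =
  c *: cliff g G (sframe i) u + cliff g G (sframe i) v.
Proof.
rewrite /cliff scaler_sumr -big_split; apply: eq_bigr => a _ /=.
by rewrite scalerA -scalerDl met_lin; congr (_ *: _); ring.
Qed.

Lemma cliff_smooth X : vsmooth W X ->
  mxsmooth W (fun y => cliff g G (sframe i) (X y)).
Proof.
move=> sX; apply: mxsmooth_sum => // a _; apply: mxsmoothZ => //.
  apply: smooth_onM => //; first exact: smooth_on_cst.
  by apply: met_smooth => //; exact: sframe_smooth.
exact: mxsmooth_cst.
Qed.

Lemma DE X (xi : spinor Sp) x :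
  D nab A X xi i x = dmx (X x) (xi i) + conn (X x) *m xi i x.
Proof. by rewrite /D dspinorE. Qed.

Lemma DextE X (w : superfun Sp) x :
  Dext nab A X w i x = dext (X x) (w i) + der (conn (X x)) (w i x).
Proof. by []. Qed.

Lemma Dext_smooth X (w : superfun Sp) : vsmooth W X -> extsmooth W (w i) ->
  extsmooth W (Dext nab A X w i).
Proof.
move=> sX sw; apply: extsmoothD => //; first exact: extsmooth_dext.
by apply: extsmooth_der => //; exact: conn_smooth.
Qed.

Lemma Dext_vec_wedge X (xi : spinor Sp) (w : superfun Sp) x : W x ->
  mxsmooth W (xi i) -> extsmooth W (w i) ->
  Dext nab A X (wedges (vecs xi) w) i x =
  wedge (vec (D nab A X xi i x)) (w i x) +
  wedge (vec (xi i x)) (Dext nab A X w i x).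
Proof.
move=> Wx sxi sw; rewrite !DextE DE /wedges /vecs.
rewrite (dext_wedge (X x) oW Wx (extsmooth_vec oW sxi) sw).
rewrite (dext_vec (X x) oW Wx sxi) der_vec_wedge vecD wedgeDl wedgeDr.
by rewrite addrACA.
Qed.

(** D on superfunctions is tensorial in its direction, so a Lie bracket of frame fields may be
    expanded in the frame at x alone. *)
Lemma Dext_sumZ (X : vfield M) (a : 'I_n -> R) (b : 'I_n -> vfield M)
    (w : superfun Sp) x :
  W x -> X x = \sum_k a k *: b k x ->
  Dext nab A X w i x = \sum_k a k *: Dext nab A (b k) w i x.
Proof.
move=> Wx e; rewrite DextE e.
apply: (linear_sumZ (f := fun u => dext u (w i) + der (conn u) (w i x))).
move=> c u v; rewrite conn_lin // derD derZ scalerDr addrACA; congr (_ + _).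
by apply/ffunP => I; rewrite !ffunE.
Qed.

Lemma Dext_sum X (w : 'I_n -> superfun Sp) x : W x ->
  (forall k, extsmooth W (w k i)) ->
  Dext nab A X (\sum_k w k) i x = \sum_k Dext nab A X (w k) i x.
Proof.
move=> Wx sw; rewrite DextE.
have -> : (\sum_k w k) i = fun y => \sum_k w k i y.
  by apply/funext => y; rewrite !fct_sumE.
by rewrite (dext_sum (X x) oW Wx) // der_sumr -big_split.
Qed.

(** Cartan's structure equation. [curvature_mx] tests on constant local sections, whose derivatives
    vanish, so D D' of them reads off one derivative of [conn] and one product. *)
Lemma curvature_mxE X Y x :
  curvature_mx nab A X Y i x =
  dmx (X x) (fun y => conn (Y y)) - dmx (Y x) (fun y => conn (X y)) +
  (conn (X x) *m conn (Y x) - conn (Y x) *m conn (X x)) -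
  conn (lie_bracket X Y x).
Proof.
have dcst y (v : tspace y) (u : 'cV[R]_N) : dmx v (fun=> u) = 0.
  apply/colP => k; rewrite !mxE; exact: (tangent_cst v openT).
have D1 Z y l : D nab A Z (fun _ _ => delta_mx l 0) i y = col l (conn (Z y)).
  by rewrite DE dcst add0r colE.
have D2 Z Z' l : D nab A Z (D nab A Z' (fun _ _ => delta_mx l 0)) i x =
    col l (dmx (Z x) (fun y => conn (Z' y)) + conn (Z x) *m conn (Z' x)).
  rewrite DE D1 [RHS]linearD /=; congr (_ + _); last by rewrite !colE mulmxA.
  apply/colP => k; rewrite !mxE; congr (_ _); apply/funext => y.
  by rewrite D1 mxE.
apply/matrixP => k l; rewrite mxE /curvature !fctE D2 D2 D1 !mxE.
ring.
Qed.

(** Second derivatives of w combine to the derivative along [X, Y], and zeroth-order terms to the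
    curvature plus [conn] of [X, Y] by [der_comm]. *)
Lemma Dext_comm X Y (w : superfun Sp) x : W x -> vsmooth W X -> vsmooth W Y ->
  extsmooth W (w i) ->
  Dext nab A X (Dext nab A Y w) i x - Dext nab A Y (Dext nab A X w) i x =
  der (curvature_mx nab A X Y i x) (w i x) +
  Dext nab A (lie_bracket X Y) w i x.
Proof.
move=> Wx sX sY sw.
have E X' Y' : vsmooth W X' -> vsmooth W Y' ->
   Dext nab A X' (Dext nab A Y' w) i x =
   dext (X' x) (fun y => dext (Y' y) (w i)) +
   (der (conn (Y' x)) (dext (X' x) (w i)) + der (conn (X' x)) (dext (Y' x) (w i))) +
   (der (dmx (X' x) (fun y => conn (Y' y))) (w i x) +
    der (conn (X' x)) (der (conn (Y' x)) (w i x))).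
  move=> sX' sY'; rewrite DextE.
  have -> : Dext nab A Y' w i =
    fun y => dext (Y' y) (w i) + der (conn (Y' y)) (w i y) by [].
  rewrite (dextD (X' x) oW Wx); first last.
  - by apply: extsmooth_der => //; exact: conn_smooth.
  - exact: extsmooth_dext.
  rewrite (dext_der (X' x) oW Wx) //; last exact: conn_smooth.
  rewrite derDr.
  by rewrite [LHS](AC ((1*2)*2) ((1*(3*4))*(2*5)))%AC.
rewrite !E // DextE curvature_mxE.
have -> : dext (lie_bracket X Y x) (w i) =
    dext (X x) (fun y => dext (Y y) (w i)) - dext (Y x) (fun y => dext (X y) (w i)).
  apply/ffunP => I; rewrite !ffunE (lie_bracketE oW Wx sX sY (sw I)).
  by congr (X x _ - Y x _); apply/funext => y; rewrite ffunE.
move: (dmx (X x) _) (dmx (Y x) _) (conn (X x)) (conn (Y x))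
  (conn (lie_bracket X Y x)) => dY dX cX cY cL.
rewrite 2!derD [der (- cL) _]derN [der (dY - dX) _]derD derN -der_comm.
rewrite [RHS]addrACA addNr addr0 [RHS]addrC.
(* Here m stands for the mixed terms, one [conn] and one derivative of w, which are symmetric in X
   and Y. *)
have e (p1 q1 m p2 q2 : ext R N) :
    p1 + m + q1 - (p2 + m + q2) = p1 - p2 + (q1 - q2).
  rewrite [p1 + m + _]addrAC [p2 + m + _]addrAC opprD addrACA subrr addr0.
  by rewrite opprD addrACA.
rewrite [der cX (dext _ _) + der cY _]addrC e; congr (_ + _).
by rewrite opprD addrACA.
Qed.

End LocalGauge.

(** * Derivatives of admissible spinors and the bracket of odd fields *)

Section AdmissibleSpinors.
Variables (R : realType) (n p N : nat) (M : manifold R n) (g : metric M)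
  (G : clifford_module R n p N) (Sp : spin_structure g G)
  (nab : affine_connection M) (C : 'M[R]_N) (A : end_form Sp) (K : set (spinor Sp)).
Hypotheses (LC : levi_civita g nab) (AA : is_end_form A).
Hypothesis KS : forall xi, K xi -> is_spinor_section xi.
Hypothesis KC : forall xi, K xi -> parallelC nab C A xi.
Hypothesis Kadm : admissible nab C A K.
Variables (W : set M) (i : gauge Sp) (b : 'I_n -> vfield M).
Hypotheses (oW : open W) (Wi : W `<=` sdom i) (bW : frame_on W b).

Lemma section_smooth xi : K xi -> mxsmooth W (xi i).
Proof.
by move=> /KS[s _] k j; rewrite (ord1 j); apply: smooth_on_sub (s i k).
Qed.

(** Solves the definition of [Dhat] for its first term; the factor 2^-1 arises because [torsion]
    counts [Dhat] twice once it is antisymmetric on K. *)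
Lemma D_clifford Z X xi x : K xi -> W x -> vsmooth W Z -> vsmooth W X ->
  D nab A Z (clifford X xi) i x =
  2^-1 *: torsion nab C A Z X xi i x +
  cliff g G (sframe i) (@nab x (Z x) X) *m xi i x.
Proof.
move=> Kxi Wx sZ sX.
have DhatE : Dhat nab C A Z X xi i x =
    D nab A Z (clifford X xi) i x - cliff g G (sframe i) (@nab x (Z x) X) *m xi i x.
  transitivity (D nab A Z (clifford X xi) i x
    - cliff g G (sframe i) (@nab x (Z x) X) *m xi i x
    - cliff g G (sframe i) (X x) *m DC nab C A Z xi i x) => //.
  by rewrite (KC Kxi oW sZ Wx (Wi Wx)) mulmx0 subr0.
have /eqP := Kadm Kxi oW sZ sX Wx (Wi Wx).
rewrite !fctE addrC addr_eq0 => /eqP anti.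
have half (u : 'cV[R]_N) : 2^-1 *: (u + u) = u.
  by rewrite -mulr2n -[u *+ 2]scaler_nat scalerA mulVf ?pnatr_eq0 // scale1r.
by rewrite /torsion !fctE anti opprK half DhatE subrK.
Qed.

Lemma clifford_smooth X xi : K xi -> vsmooth W X ->
  mxsmooth W (clifford X xi i).
Proof.
move=> Kxi sX; apply: mxsmoothM => //; last exact: section_smooth.
exact: cliff_smooth.
Qed.

Lemma gamma_up_smooth nu xi : K xi -> mxsmooth W (gamma_up b nu xi i).
Proof.
move=> Kxi; have [sb _] := bW.
apply: mxsmooth_sum => // rho _; apply: mxsmoothZ => //.
  exact: (mxsmooth_ginv g oW bW).
exact: clifford_smooth.
Qed.

(** With H the inverse Gram matrix, dH = - H Gam - Gam^T H, while differentiating the frame in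
    gamma(e_rho) contributes H Gam. What survives is - Gam^T H, the Christoffel term for an upper
    index. *)
Lemma D_gamma_up Z (Gam : 'M[R]_n) nu xi x : K xi -> W x -> vsmooth W Z ->
  (forall rho, @nab x (Z x) (b rho) = \sum_s Gam rho s *: b s x) ->
  D nab A Z (gamma_up b nu xi) i x =
  2^-1 *: (\sum_rho ginv g b x nu rho *: torsion nab C A Z (b rho) xi i x)
  - \sum_lam Gam lam nu *: gamma_up b lam xi i x.
Proof.
move=> Kxi Wx sZ GamE; have [sb _] := bW.
have sh rho : smooth_on W (fun y => ginv g b y nu rho).
  exact: (mxsmooth_ginv g oW bW).
have sc rho : mxsmooth W (clifford (b rho) xi i) by exact: clifford_smooth.
pose c s := clifford (b s) xi i x; pose h := ginv g b x.
transitivity (\sum_rho (dmx (Z x) (ginv g b) nu rho *: c rho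
    + h nu rho *: D nab A Z (clifford (b rho) xi) i x)).
  rewrite DE (dmx_sum (Z x) oW Wx) => [|rho _]; last exact: mxsmoothZ.
  rewrite mulmx_sumr -big_split; apply: eq_bigr => rho _ /=.
  by rewrite (dmxZ (Z x) oW Wx) // DE mxE scalerDr -scalemxAr addrA.
have cliffE rho : cliff g G (sframe i) (@nab x (Z x) (b rho)) *m xi i x =
    \sum_s Gam rho s *: c s.
  rewrite GamE (linear_sumZ (f := fun u => cliff g G (sframe i) u)).
    by rewrite mulmx_suml; apply: eq_bigr => s _; rewrite -scalemxAl.
  by move=> *; exact: cliff_lin.
transitivity (\sum_rho (dmx (Z x) (ginv g b) nu rho *: c rho
    + (2^-1 *: (h nu rho *: torsion nab C A Z (b rho) xi i x)
       + \sum_s (h nu rho * Gam rho s) *: c s))).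
  apply: eq_bigr => rho _; rewrite D_clifford // scalerDr cliffE scaler_sumr.
  congr (_ + (_ + _)); first by rewrite !scalerA mulrC.
  by apply: eq_bigr => s _; rewrite scalerA.
rewrite 2!big_split /= -scaler_sumr addrCA; congr (_ + _).
rewrite exchange_big -big_split /=.
transitivity (\sum_s - ((Gam^T *m h) nu s) *: c s).
  apply: eq_bigr => s _; rewrite -scaler_suml -scalerDl; congr (_ *: _).
  rewrite (dmx_ginv oW bW LC Wx GamE) !mxE; ring.
transitivity (- \sum_s \sum_l (Gam l nu * h l s) *: c s).
  rewrite -sumrN; apply: eq_bigr => s _; rewrite scaleNr mxE scaler_suml.
  by congr (- _); apply: eq_bigr => l _; rewrite mxE.
rewrite exchange_big; congr (- _); apply: eq_bigr => l _.
by rewrite /gamma_up scaler_sumr; apply: eq_bigr => s _; rewrite scalerA.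
Qed.

Lemma imathE xi (w : superfun Sp) x :
  imath nab A b xi w i x =
  \sum_mu wedge (vec (gamma_up b mu xi i x)) (Dext nab A (b mu) w i x).
Proof. by rewrite /imath !fct_sumE. Qed.

Lemma imath_imathE phi psi (w : superfun Sp) x :
  K phi -> K psi -> extsmooth W (w i) -> W x ->
  imath nab A b phi (imath nab A b psi w) i x =
  \sum_mu \sum_nu wedge (vec (gamma_up b mu phi i x))
    (wedge (vec (D nab A (b mu) (gamma_up b nu psi) i x)) (Dext nab A (b nu) w i x) +
     wedge (vec (gamma_up b nu psi i x))
       (Dext nab A (b mu) (Dext nab A (b nu) w) i x)).
Proof.
move=> Kphi Kpsi sw Wx; have [sb _] := bW.
rewrite imathE; apply: eq_bigr => mu _; rewrite -wedge_sumr; congr (wedge _ _).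
have sD nu : extsmooth W (Dext nab A (b nu) w i) by exact: Dext_smooth.
rewrite [imath nab A b psi w]/imath (Dext_sum nab A oW) // => [|nu].
  apply: eq_bigr => nu _.
  by rewrite (Dext_vec_wedge nab A oW) //; exact: gamma_up_smooth.
apply: extsmooth_wedge => //; apply: extsmooth_vec => //; exact: gamma_up_smooth.
Qed.

Lemma imath_comm phi psi (w : superfun Sp) x :
  K phi -> K psi -> extsmooth W (w i) -> W x ->
  gcomm true true (imath nab A b phi) (imath nab A b psi) w i x =
  frakB nab A b phi psi w i x + 2^-1 *: frakD nab C A b phi psi w i x.
Proof.
move=> Kphi Kpsi sw Wx; have [sb bx] := bW; have [_ _ torsionfree] := LC.
(* Christoffel coefficients at the single point x, chosen from the frame expansions of all nabla_mu
   e_r. *)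
have [c cE] := choice (fun mr : 'I_n * 'I_n =>
  let: ex_intro c (conj e _) := bx x (@nab x (b mr.1 x) (b mr.2)) Wx in
  ex_intro _ c e).
pose Gam mu r s := c (mu, r) 0 s.
have GamE mu r : @nab x (b mu x) (b r) = \sum_s Gam mu r s *: b s x.
  exact: (cE (mu, r)).
have DgE mu nu xi : K xi -> D nab A (b mu) (gamma_up b nu xi) i x =
  2^-1 *: (\sum_rho ginv g b x nu rho *: torsion nab C A (b mu) (b rho) xi i x)
  - \sum_lam Gam mu lam nu *: gamma_up b lam xi i x.
  move=> Kxi; rewrite (@D_gamma_up _ (\matrix_(r, s) Gam mu r s)) //.
    by congr (_ - _); apply: eq_bigr => l _; rewrite mxE.
  by move=> rho; rewrite GamE; apply: eq_bigr => s _; rewrite mxE.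
transitivity (imath nab A b phi (imath nab A b psi w) i x +
              imath nab A b psi (imath nab A b phi w) i x).
  by rewrite /gcomm !fctE expr1 scaleN1r opprK.
rewrite !imath_imathE //.
rewrite (sum_covariant_commutator (c := 2^-1) (h := ginv g b x) (Gam := Gam)
  (Tu := fun mu nu => torsion nab C A (b mu) (b nu) phi i x)
  (Tv := fun mu nu => torsion nab C A (b mu) (b nu) psi i x)
  (k := fun mu nu => der (curvature_mx nab A (b mu) (b nu) i x) (w i x))).
- congr (_ + _ *: _).
    rewrite /frakB !fct_sumE; apply: eq_bigr => mu _.
    by rewrite !fct_sumE.
  rewrite /frakD !fct_sumE; apply: eq_bigr => mu _.
  rewrite !fct_sumE; apply: eq_bigr => nu _.
  congr (wedge _ _); apply: eq_bigr => rho _.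
  by rewrite ginv_sym.
- by move=> mu nu; exact: DgE.
- by move=> mu nu; exact: DgE.
move=> mu nu; rewrite (Dext_comm LC AA oW Wi) //; congr (_ + _).
(* Vanishing torsion of nabla makes these differences the frame coefficients of [e_mu, e_nu] at x;
   they produce the two connection sums required of zz mu nu - zz nu mu. *)
rewrite (Dext_sumZ A LC oW Wi (a := fun l => Gam mu nu l - Gam nu mu l) (b := b)) //.
  by rewrite -sumrB; apply: eq_bigr => l _; rewrite scalerBl.
rewrite -torsionfree; [|exact: vsmooth_on_at Wx (sb _)..].
by rewrite !GamE -sumrB; apply: eq_bigr => l _; rewrite scalerBl.
Qed.

End AdmissibleSpinors.

Theorem proposition6 (R : realType) (n p N : nat) (M : manifold R n)
    (g : metric M) (G : clifford_module R n p N) (S : spin_structure g G)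
    (nab : affine_connection M) (C : 'M[R]_N) (A : end_form S)
    (K : set (spinor S)) :
  levi_civita g nab ->
  charge_conjugation S C ->
  is_end_form A ->
  linear_subspace K ->
  (forall xi, K xi -> is_spinor_section xi) ->
  (forall xi, K xi -> parallelC nab C A xi) ->
  admissible nab C A K ->
  forall phi psi, K phi -> K psi ->
  forall (U : set M) (b : 'I_n -> vfield M), open U -> frame_on U b ->
  forall w : superfun S, is_superfun_section w ->
  forall (i : gauge S) (x : M), U x -> sdom i x ->
    gcomm true true (imath nab A b phi) (imath nab A b psi) w i x =
    frakB nab A b phi psi w i x + 2^-1 *: frakD nab C A b phi psi w i x.
Proof.
move=> LC _ AA _ KS KC Kadm phi psi Kphi Kpsi U b oU [sb bU] w [sw _] i x Ux ix.
(* On this intersection the frame [b] and the representatives in the gauge i are smooth together. *)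
have WU : U `&` sdom i `<=` U by move=> y [].
have Wi : U `&` sdom i `<=` sdom i by move=> y [].
have oW : open (U `&` sdom i) by apply: openI => //; exact: sdom_open.
apply: (imath_comm LC AA KS KC Kadm oW Wi) => //.
  by split=> [mu|y v /WU]; [exact: vsmooth_sub (sb mu)|exact: bU].
by move=> I; exact: smooth_on_sub (sw i I).
Qed.
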